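(* Let $R$ be a ring and let $X$ be a bounded below complex of left $R$-modules. Then there exists a complex $P$ consisting of pure projective left $R$-modules such that (1) there is a pure quasi-isomorphism $f:P\to X$, and (2) $\mathrm{Hom}_R(P,-)$ takes pure exact complexes of left $R$-modules to pure exact complexes of abelian groups. That is, $f:P\to X$ is a pure projective resolution of $X$.
   Context: Complexes are cochain complexes with differentials $d_X^i:X^i\to X^{i+1}$; bounded below means $X^i=0$ for $i\ll 0$. A short exact sequence of modules is pure exact if it remains exact after applying $M\otimes_R-$ for every right $R$-module $M$; its first map is pure monic and its second pure epic. A module $P$ is pure projective if $\mathrm{Hom}_R(P,-)$ takes pure exact sequences to exact sequences. A complex $X$ is pure exact at $n$ if for $k=n-1,n$ the map $X^k\to\mathrm{Im}\,d^k_X$ is pure epic and $\mathrm{Im}\,d^k_X\to X^{k+1}$ pure monic, and $0\to\mathrm{Ker}\,d_X^n\to X^n\to\mathrm{Coker}\,d_X^{n-1}\to 0$ is pure exact; $X$ is pure exact if pure exact at all $n$ (same definition for complexes of abelian groups, with $R=\mathbb{Z}$). A cochain map is a pure quasi-isomorphism if its mapping cone is pure exact. $\mathrm{Hom}_R(P,X)$ is the total Hom complex with $\mathrm{Hom}_R(P,X)^n=\prod_i\mathrm{Hom}_R(P^i,X^{i+n})$ and $d^n(\varphi)=(d_X^{i+n}\varphi^i-(-1)^n\varphi^{i+1}d_P^i)_i$. A pure projective resolution of $X$ is a pure quasi-isomorphism $P\to X$ with $P$ a complex of pure projective modules such that $\mathrm{Hom}_R(P,-)$ preserves pure exact complexes.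 *)

(* Defs.v *)
From HB Require Import structures.
From mathcomp Require Import all_boot all_order all_algebra.
Set Implicit Arguments. Unset Strict Implicit. Unset Printing Implicit Defensive.
Import Order.TTheory GRing.Theory Num.Theory.
Local Open Scope ring_scope.

(* Raw additive data of a module over S: carrier with 0, +, -, and scaling.  *)
(* Used so that both modules (lmodType) and Hom-groups (dependent products)  *)
(* can be handled uniformly.                                                 *)
Record mops (S : pzRingType) := MOps {
  mcar :> Type;
  mzero : mcar;
  madd : mcar -> mcar -> mcar;
  mopp : mcar -> mcar;
  mscale : S -> mcar -> mcar }.

Definition lmod_mops (S : pzRingType) (B : lmodType S) : mops S :=
  @MOps S B 0 +%R -%R *:%R.

(* A subquotient K/Q of B (K, Q predicates for submodules Q <= K).           *)
(* A map beta : M x B -> G is R-balanced on K/Q if it is biadditive and      *)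
(* balanced on K and vanishes on Q; these are exactly the balanced maps      *)
(* M x (K/Q) -> G. M is a right S-module, i.e. a left S^c-module.            *)
Definition balanced (S : pzRingType) (M : lmodType S^c) (B : mops S)
  (K Q : B -> Prop) (G : zmodType) (beta : M -> B -> G) : Prop :=
  [/\ forall m m' b, K b -> beta (m + m') b = beta m b + beta m' b,
      forall m b b', K b -> K b' -> beta m (madd b b') = beta m b + beta m b',
      forall (r : S) m b, K b -> beta (@GRing.scale S^c M r m) b = beta m (mscale r b)
    & forall m b, Q b -> beta m b = 0].

(* Elements of M (x)_S (K/Q) are finite sums of pure tensors m (x) b,        *)
(* represented by lists of pairs (m, b) with b in K; two such represent the   *)
(* same element iff every balanced map takes the same value on them.          *)
Definition tens_el (S : pzRingType) (M : lmodType S^c) (B : mops S)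
  (K : B -> Prop) (s : seq (M * B)) : Prop := foldr (fun p P => K p.2 /\ P) True s.

Definition teq (S : pzRingType) (M : lmodType S^c) (B : mops S)
  (K Q : B -> Prop) (s t : seq (M * B)) : Prop :=
  forall (G : zmodType) (beta : M -> B -> G), balanced K Q beta ->
    \sum_(p <- s) beta p.1 p.2 = \sum_(p <- t) beta p.1 p.2.

Definition tmap (S : pzRingType) (M : lmodType S^c) (B1 B2 : mops S)
  (phi : B1 -> B2) (s : seq (M * B1)) : seq (M * B2) :=
  map (fun p => (p.1, phi p.2)) s.

(* Ti given by an element predicate Ei, an equality eqi and a zero zi.       *)
Definition ses_exact (T1 T2 T3 : Type)
  (E1 : T1 -> Prop) (E2 : T2 -> Prop) (E3 : T3 -> Prop)
  (eq1 : T1 -> T1 -> Prop) (eq2 : T2 -> T2 -> Prop) (eq3 : T3 -> T3 -> Prop)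
  (z1 : T1) (z2 : T2) (z3 : T3) (phi : T1 -> T2) (psi : T2 -> T3) : Prop :=
  [/\ forall x, E1 x -> eq2 (phi x) z2 -> eq1 x z1,
      forall y, E2 y -> (eq3 (psi y) z3 <-> exists x, E1 x /\ eq2 (phi x) y)
    & forall z, E3 z -> exists y, E2 y /\ eq3 (psi y) z].

Definition sq_eq (S : pzRingType) (B : mops S) (Q : B -> Prop) (x y : B) :=
  Q (madd x (mopp y)).

(* Pure exactness of 0 -> K1/Q1 -> K2/Q2 -> K3/Q3 -> 0 (maps induced by phi, *)
(* psi): exact, and still exact after applying M (x)_S - for every right     *)
(* S-module M.                                                                *)
Definition pure_ses (S : pzRingType) (B1 B2 B3 : mops S)
  (K1 Q1 : B1 -> Prop) (K2 Q2 : B2 -> Prop) (K3 Q3 : B3 -> Prop)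
  (phi : B1 -> B2) (psi : B2 -> B3) : Prop :=
  ses_exact K1 K2 K3 (sq_eq Q1) (sq_eq Q2) (sq_eq Q3)
    (mzero B1) (mzero B2) (mzero B3) phi psi /\
  forall M : lmodType S^c,
    ses_exact (@tens_el S M B1 K1) (@tens_el S M B2 K2) (@tens_el S M B3 K3)
      (@teq S M B1 K1 Q1) (@teq S M B2 K2 Q2) (@teq S M B3 K3 Q3)
      [::] [::] [::] (tmap phi) (tmap psi).

(* A raw complex: components C n (the actual module being the submodule      *)
(* A n of C n) and differentials d n : C n -> C (n+1).                        *)
Section RawComplex.
Variables (S : pzRingType) (C : int -> mops S) (A : forall n, C n -> Prop)
  (d : forall n, C n -> C (n + 1)).

Definition rker n (x : C n) : Prop := A x /\ d x = mzero (C (n + 1)).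
Definition rim n (y : C (n + 1)) : Prop := exists x, A x /\ d x = y.
Definition rzero n (x : C n) : Prop := x = mzero (C n).

(* X^k -> Im d^k is pure epic: 0 -> Ker d^k -> X^k -> Im d^k -> 0 pure exact *)
Definition pure_epic_at k :=
  pure_ses (@rker k) (@rzero k) (@A k) (@rzero k) (@rim k) (@rzero (k + 1))
    id (@d k).
(* Im d^k -> X^(k+1) is pure monic:                                         *)
(*   0 -> Im d^k -> X^(k+1) -> Coker d^k -> 0 pure exact                     *)
Definition pure_monic_at k :=
  pure_ses (@rim k) (@rzero (k + 1)) (@A (k + 1)) (@rzero (k + 1))
    (@A (k + 1)) (@rim k) id id.
(* 0 -> Ker d^(k+1) -> X^(k+1) -> Coker d^k -> 0 pure exact                  *)
Definition pure_kercoker_at k :=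
  pure_ses (@rker (k + 1)) (@rzero (k + 1)) (@A (k + 1)) (@rzero (k + 1))
    (@A (k + 1)) (@rim k) id id.

(* pure exact at every n  <=>  for every k: the conditions for the index k   *)
(* (used at n = k and n = k+1) and the short sequence at n = k + 1.          *)
Definition raw_pure_exact : Prop :=
  forall k, [/\ pure_epic_at k, pure_monic_at k & pure_kercoker_at k].
End RawComplex.

Record complex (R : pzRingType) := Complex {
  obj : int -> lmodType R;
  dif : forall n, {linear obj n -> obj (n + 1)};
  dif_sq : forall n (x : obj n), dif (n + 1) (dif n x) = 0 }.

Definition bounded_below (R : pzRingType) (X : complex R) : Prop :=
  exists n0 : int, forall i : int, i < n0 -> forall x : obj X i, x = 0.

Definition pure_exact_cx (R : pzRingType) (X : complex R) : Prop :=
  @raw_pure_exact R (fun n => lmod_mops (obj X n)) (fun _ _ => True)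
    (fun n => dif X n).

Record cochain_map (R : pzRingType) (P X : complex R) := CochainMap {
  cmap : forall n, {linear obj P n -> obj X n};
  cmap_comm : forall n (x : obj P n),
    cmap (n + 1) (dif P n x) = dif X n (cmap n x) }.

Definition cone_d (R : pzRingType) (P X : complex R) (f : cochain_map P X)
  (n : int) (px : (obj P (n + 1) * obj X n)%type) :
  (obj P (n + 1 + 1) * obj X (n + 1))%type :=
  (- dif P (n + 1) px.1, cmap f (n + 1) px.1 + dif X n px.2).

Definition pure_quasi_iso (R : pzRingType) (P X : complex R)
  (f : cochain_map P X) : Prop :=
  @raw_pure_exact R (fun n => lmod_mops (obj P (n + 1) * obj X n)%type)
    (fun _ _ => True) (@cone_d R P X f).

Definition is_linear (R : pzRingType) (U V : lmodType R) (h : U -> V) : Prop :=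
  forall (a : R) (u v : U), h (a *: u + v) = a *: h u + h v.

Definition pure_projective (R : pzRingType) (P : lmodType R) : Prop :=
  forall (A B C : lmodType R) (f : {linear A -> B}) (g : {linear B -> C}),
    pure_ses (B1 := lmod_mops A) (B2 := lmod_mops B) (B3 := lmod_mops C)
      (fun _ => True) (fun x => x = 0) (fun _ => True) (fun x => x = 0)
      (fun _ => True) (fun x => x = 0) f g ->
    ses_exact (@is_linear R P A) (@is_linear R P B) (@is_linear R P C)
      (fun h h' => forall x, h x = h' x) (fun h h' => forall x, h x = h' x)
      (fun h h' => forall x, h x = h' x)
      (fun _ => 0) (fun _ => 0) (fun _ => 0)
      (fun h => f \o h) (fun h => g \o h).

(* Hom_R(P,Y)^n = prod_i Hom_R(P^i, Y^(i+n)), an abelian group (Z-module).   *)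
Definition hom_car (R : pzRingType) (P Y : complex R) (n : int) : Type :=
  forall i : int, obj P i -> obj Y (i + n).

Definition hom_mops (R : pzRingType) (P Y : complex R) (n : int) : mops int :=
  @MOps int (hom_car P Y n)
    (fun i _ => 0)
    (fun phi psi i x => phi i x + psi i x)
    (fun phi i x => - phi i x)
    (fun z phi i x => phi i x *~ z).

Definition hom_lin (R : pzRingType) (P Y : complex R) (n : int)
  (phi : hom_car P Y n) : Prop := forall i, is_linear (phi i).

Lemma hom_eA (i n : int) : i + n + 1 = i + (n + 1).
Proof. by rewrite addrA. Qed.
Lemma hom_eB (i n : int) : i + 1 + n = i + (n + 1).
Proof. by rewrite addrAC addrA. Qed.

Definition castc (R : pzRingType) (Y : complex R) (a b : int) (e : a = b)
  (y : obj Y a) : obj Y b := eq_rect a (fun k => obj Y k : Type) y b e.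

Definition hom_d (R : pzRingType) (P Y : complex R) (n : int)
  (phi : hom_car P Y n) : hom_car P Y (n + 1) :=
  fun i x => castc (hom_eA i n) (dif Y (i + n) (phi i x))
           - castc (hom_eB i n) (phi (i + 1) (dif P i x)) *~ ((-1) ^ n).

Definition hom_pure_exact (R : pzRingType) (P Y : complex R) : Prop :=
  @raw_pure_exact int (hom_mops P Y) (@hom_lin R P Y) (@hom_d R P Y).

(* Main.v *)
From HB Require Import structures.
Require Import Defs.
From mathcomp Require Import all_boot all_order all_algebra.
From mathcomp Require Import boolp.
Set Implicit Arguments. Unset Strict Implicit. Unset Printing Implicit Defensive.
Import GRing.Theory.
Local Open Scope ring_scope.

(** The resolution is cellular.  A raw term of degree [n] is a formal linear
    combination of generators of cells; a cell is a finitely presented module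
    (given by a matrix [a]) together with its attaching data: raw terms [z] of
    degree [n + 1] and elements [y] of [X n].  A cell whose data form a cocycle
    of the cone gets differential [z] and image [y] in [X], so each map from a
    finitely presented module to the cocycles of the cone bounds by construction.
    Cells are indexed by raw terms, not by their classes; hence in each degree
    the resolution is a direct sum of finitely presented modules, and maps out of
    it are defined by structural recursion on terms.  For pure exact [Y] such a
    recursion produces a primitive of any cocycle of [Hom(P, Y)]; running it on
    several cocycles subject to integral linear relations gives purity over the
    integers.

    Purity in terms of tensor products is translated into solvability of finite
    linear systems in both directions. *)

(** * Quotients of setoids *)

Record setoid_zmod (T : Type) (zero : T) (add : T -> T -> T) (opp : T -> T)
    (E : T -> T -> Prop) : Prop := SetoidZmod {
  ssym : forall x y, E x y -> E y x;
  strans : forall x y z, E x y -> E y z -> E x z;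
  saddE : forall x x' y y', E x x' -> E y y' -> E (add x y) (add x' y');
  soppE : forall x x', E x x' -> E (opp x) (opp x');
  saddA : forall x y z, E (add x (add y z)) (add (add x y) z);
  saddC : forall x y, E (add x y) (add y x);
  sadd0 : forall x, E (add zero x) x;
  saddN : forall x, E (add (opp x) x) zero }.

Section QuotientZmod.
Variables (T : Type) (zero : T) (add : T -> T -> T) (opp : T -> T).
Variables (E : T -> T -> Prop) (laws : setoid_zmod zero add opp E).

(** Classes are the predicates [E t] themselves, so that extensionality turns equivalence under [E]
    into Leibniz equality. *)
Definition qclass := {C : T -> Prop | exists t, C = E t}.

HB.instance Definition _ := gen_eqMixin qclass.
HB.instance Definition _ := gen_choiceMixin qclass.

Definition qpi (t : T) : qclass := exist _ (E t) (ex_intro _ t erefl).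
Definition qrepr (c : qclass) : T := projT1 (cid (svalP c)).

Lemma qreprK c : qpi (qrepr c) = c.
Proof.
apply: eq_sig_hprop => [C|]; first exact: Prop_irrelevance.
rewrite /qrepr; case: cid => t /= ->; exact: erefl.
Qed.

(** Reflexivity is derived from the other laws by passing from [x] to [add zero x] and back. *)
Lemma srefl x : E x x.
Proof. exact: (strans laws) (ssym laws (sadd0 laws x)) (sadd0 laws x). Qed.

Lemma qpiP x y : qpi x = qpi y <-> E x y.
Proof.
split=> [[->]|Exy]; first exact: srefl.
apply: eq_sig_hprop => [C|]; first exact: Prop_irrelevance.
apply: funext => z; apply: propext; split; last exact: (strans laws).
exact: (strans laws) (ssym laws Exy).
Qed.

Lemma qreprP t : E (qrepr (qpi t)) t.
Proof. by apply/qpiP; rewrite qreprK. Qed.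

Let qadd c c' := qpi (add (qrepr c) (qrepr c')).
Let qopp c := qpi (opp (qrepr c)).

Let qaddE x y : qadd (qpi x) (qpi y) = qpi (add x y).
Proof. by apply/qpiP; apply: (saddE laws); exact: qreprP. Qed.
Let qoppE x : qopp (qpi x) = qpi (opp x).
Proof. by apply/qpiP; apply: (soppE laws); exact: qreprP. Qed.

Let qind (P : qclass -> Prop) : (forall t, P (qpi t)) -> forall c, P c.
Proof. by move=> Pt c; rewrite -(qreprK c). Qed.

Let qaddA : associative qadd.
Proof.
move=> x y z; elim/qind: x => x; elim/qind: y => y; elim/qind: z => z.
by rewrite !qaddE; apply/qpiP/(saddA laws).
Qed.
Let qaddC : commutative qadd.
Proof.
move=> x y; elim/qind: x => x; elim/qind: y => y.
by rewrite !qaddE; apply/qpiP/(saddC laws).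
Qed.
Let qadd0 : left_id (qpi zero) qadd.
Proof. by elim/qind=> x; rewrite qaddE; apply/qpiP/(sadd0 laws). Qed.
Let qaddN : left_inverse (qpi zero) qopp qadd.
Proof. by elim/qind=> x; rewrite qoppE qaddE; apply/qpiP/(saddN laws). Qed.

Definition quot_zmod : zmodType :=
  HB.pack qclass
    (GRing.isZmodule.Build qclass qaddA qaddC qadd0 qaddN).

Definition zpi : T -> quot_zmod := qpi.
Definition zrepr : quot_zmod -> T := qrepr.

Lemma zreprK c : zpi (zrepr c) = c. Proof. exact: qreprK. Qed.
Lemma zpiP x y : zpi x = zpi y <-> E x y. Proof. exact: qpiP. Qed.
Lemma zreprP t : E (zrepr (zpi t)) t. Proof. exact: qreprP. Qed.
Lemma zpi0 : zpi zero = 0. Proof. by []. Qed.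
Lemma zpiD x y : zpi (add x y) = zpi x + zpi y. Proof. exact/esym/qaddE. Qed.
Lemma zpiN x : zpi (opp x) = - zpi x. Proof. exact/esym/qoppE. Qed.
Lemma zpi_eq0 x : zpi x = 0 <-> E x zero. Proof. by rewrite -zpi0; exact: zpiP. Qed.

Section Scaling.
Variables (S : pzRingType) (sc : S -> T -> T).

Record setoid_scale : Prop := SetoidScale {
  sscE : forall a x x', E x x' -> E (sc a x) (sc a x');
  sscA : forall a b x, E (sc a (sc b x)) (sc (a * b) x);
  ssc1 : forall x, E (sc 1 x) x;
  sscDr : forall a x y, E (sc a (add x y)) (add (sc a x) (sc a y));
  sscDl : forall x a b, E (sc (a + b) x) (add (sc a x) (sc b x)) }.

Hypothesis slaws : setoid_scale.

Let qsc a (c : quot_zmod) := zpi (sc a (zrepr c)).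
Let qscE a x : qsc a (zpi x) = zpi (sc a x).
Proof. by apply/qpiP; apply: (sscE slaws); exact: qreprP. Qed.
Let qscA a b v : qsc a (qsc b v) = qsc (a * b) v.
Proof. by rewrite -(zreprK v) !qscE; apply/zpiP/(sscA slaws). Qed.
Let qsc1 : left_id 1 qsc.
Proof. by move=> v; rewrite -(zreprK v) !qscE; apply/zpiP/(ssc1 slaws). Qed.
Let qscDr : right_distributive qsc +%R.
Proof.
move=> a u v; rewrite -(zreprK v) -(zreprK u) -zpiD !qscE -zpiD.
exact/zpiP/(sscDr slaws).
Qed.
Let qscDl v : {morph qsc^~ v : a b / a + b}.
Proof.
by move=> a b; rewrite -(zreprK v) /= !qscE -zpiD; exact/zpiP/(sscDl slaws).
Qed.

Definition quot_lmod : lmodType S :=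
  HB.pack quot_zmod (GRing.Zmodule_isLmodule.Build S quot_zmod qscA qsc1 qscDr qscDl).

Definition lpi : T -> quot_lmod := zpi.
Definition lrepr : quot_lmod -> T := zrepr.

Lemma lreprK c : lpi (lrepr c) = c. Proof. exact: zreprK. Qed.
Lemma lpiP x y : lpi x = lpi y <-> E x y. Proof. exact: zpiP. Qed.
Lemma lreprP t : E (lrepr (lpi t)) t. Proof. exact: zreprP. Qed.
Lemma lpi0 : lpi zero = 0. Proof. by []. Qed.
Lemma lpiD x y : lpi (add x y) = lpi x + lpi y. Proof. exact: zpiD. Qed.
Lemma lpiN x : lpi (opp x) = - lpi x. Proof. exact: zpiN. Qed.
Lemma lpiZ a x : lpi (sc a x) = a *: lpi x. Proof. exact/esym/qscE. Qed.

End Scaling.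
End QuotientZmod.

(** * From purity to linear systems *)

Lemma setoid_zmod_sub (V : zmodType) (N : V -> Prop) :
  N 0 -> (forall x y, N x -> N y -> N (x - y)) ->
  setoid_zmod 0 +%R -%R (fun x y : V => N (x - y)).
Proof.
move=> N0 NB.
have NN x : N x -> N (- x) by move=> Nx; rewrite -(sub0r x); exact: NB.
have ND x y : N x -> N y -> N (x + y).
  by move=> Nx Ny; rewrite -(opprK y); apply: NB => //; exact: NN.
split=> [x y Nxy|x y z Nxy Nyz|x x' y y' Nx Ny|x x' Nx|x y z|x y|x|x].
- by rewrite -opprB; exact: NN.
- by rewrite -(subrKA y); exact: ND.
- by rewrite opprD addrACA; exact: ND.
- by rewrite -opprD; exact: NN.
- by rewrite addrA subrr.
- by rewrite (addrC x) subrr.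
- by rewrite add0r subrr.
- by rewrite addNr subrr.
Qed.

Lemma setoid_scale_sub (S : pzRingType) (V : lmodType S) (N : V -> Prop) :
  N 0 -> (forall a x, N x -> N (a *: x)) ->
  setoid_scale +%R (fun x y : V => N (x - y)) *:%R.
Proof.
move=> N0 NZ; split=> [a x x' Nx|a b x|x|a x y|x a b].
- by rewrite -scalerBr; exact: NZ.
- by rewrite scalerA subrr.
- by rewrite scale1r subrr.
- by rewrite scalerDr subrr.
- by rewrite scalerDl subrr.
Qed.

(** * Elementary calculus of submodules, balanced maps and linear maps *)

Definition submodule (S : pzRingType) (B : lmodType S) (K : B -> Prop) : Prop :=
  K 0 /\ forall a x y, K x -> K y -> K (a *: x + y).

Section Submodule.
Variables (S : pzRingType) (B : lmodType S) (K : B -> Prop).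
Hypothesis subK : submodule K.

Lemma submod0 : K 0. Proof. by case: subK. Qed.
Lemma submodD x y : K x -> K y -> K (x + y).
Proof. by move=> Kx Ky; rewrite -(scale1r x); apply: subK.2. Qed.
Lemma submodZ a x : K x -> K (a *: x).
Proof. by move=> Kx; rewrite -(addr0 (_ *: _)); apply: subK.2; first by []; exact: submod0. Qed.
Lemma submodN x : K x -> K (- x).
Proof. by move=> Kx; rewrite -scaleN1r; exact: submodZ. Qed.
Lemma submodB x y : K x -> K y -> K (x - y).
Proof. by move=> Kx Ky; apply: submodD => //; exact: submodN. Qed.
Lemma submod_sum (I : Type) (r : seq I) (F : I -> B) :
  (forall i, K (F i)) -> K (\sum_(i <- r) F i).
Proof. by move=> KF; apply: big_ind => //; [exact: submod0|exact: submodD]. Qed.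

End Submodule.

Section Balanced.
Variables (S : pzRingType) (M : lmodType S^c) (B : lmodType S) (K Q : B -> Prop).
Variables (G : zmodType) (beta : M -> B -> G).
Hypotheses (subK : submodule K).
Hypothesis bal : balanced (B := lmod_mops B) K Q beta.

Lemma balDl m m' b : K b -> beta (m + m') b = beta m b + beta m' b.
Proof. by move=> Kb; case: bal => H _ _ _; exact: H. Qed.
Lemma balDr m b b' : K b -> K b' -> beta m (b + b') = beta m b + beta m b'.
Proof. by move=> Kb Kb'; case: bal => _ H _ _; exact: H. Qed.
Lemma balZ (r : S) m b : K b -> beta (@GRing.scale S^c M r m) b = beta m (r *: b).
Proof. by move=> Kb; case: bal => _ _ H _; exact: H. Qed.
Lemma bal0l b : K b -> beta 0 b = 0.
Proof. by move=> Kb; apply: (addrI (beta 0 b)); rewrite -balDl // !addr0. Qed.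
Lemma bal0r m : beta m 0 = 0.
Proof.
have K0 := submod0 subK.
by apply: (addrI (beta m 0)); rewrite -balDr // !addr0.
Qed.
Lemma balNl m b : K b -> beta (- m) b = - beta m b.
Proof. by move=> Kb; apply: (addrI (beta m b)); rewrite -balDl // !subrr bal0l. Qed.
Lemma bal_suml (I : Type) (r : seq I) (F : I -> M) b : K b ->
  beta (\sum_(i <- r) F i) b = \sum_(i <- r) beta (F i) b.
Proof.
move=> Kb; elim: r => [|i r IH]; first by rewrite !big_nil bal0l.
by rewrite !big_cons balDl // IH.
Qed.
Lemma bal_sumr (I : Type) (r : seq I) (F : I -> B) m : (forall i, K (F i)) ->
  beta m (\sum_(i <- r) F i) = \sum_(i <- r) beta m (F i).
Proof.
move=> KF; elim: r => [|i r IH]; first by rewrite !big_nil bal0r.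
by rewrite !big_cons balDr ?IH //; exact: submod_sum.
Qed.

End Balanced.

Section LinearMaps.
Variables (S : pzRingType) (U V : lmodType S) (h : U -> V).
Hypothesis lin : is_linear h.

Lemma islin0 : h 0 = 0.
Proof. by have := lin (-1) 0 0; rewrite scaleN1r oppr0 addr0 scaleN1r addNr. Qed.
Lemma islinD x y : h (x + y) = h x + h y.
Proof. by rewrite -{1}(scale1r x) lin scale1r. Qed.
Lemma islinZ a x : h (a *: x) = a *: h x.
Proof. by rewrite -(addr0 (_ *: x)) lin islin0 addr0. Qed.
Lemma islinN x : h (- x) = - h x.
Proof. by rewrite -scaleN1r islinZ scaleN1r. Qed.
Lemma islinB x y : h (x - y) = h x - h y.
Proof. by rewrite islinD islinN. Qed.
Lemma islin_sum (I : Type) (r : seq I) (F : I -> U) :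
  h (\sum_(i <- r) F i) = \sum_(i <- r) h (F i).
Proof.
elim: r => [|i r IH]; first by rewrite !big_nil islin0.
by rewrite !big_cons islinD IH.
Qed.
End LinearMaps.

Lemma tens_el_map (S : pzRingType) (M : lmodType S^c) (B : mops S) (K : B -> Prop)
  (I : Type) (r : seq I) (F : I -> M) (G : I -> B) :
  (forall i, K (G i)) -> @tens_el S M B K [seq (F i, G i) | i <- r].
Proof. by move=> KG; elim: r => //= i r IH; split=> //; exact: KG. Qed.

(** * Lifting solutions of finite linear systems along a pure epimorphism *)

Section SystemLift.
Variables (S : pzRingType) (B1 B2 B3 : lmodType S).
Variables (K1 : B1 -> Prop) (K2 : B2 -> Prop) (K3 : B3 -> Prop).
Variables (phi : B1 -> B2) (psi : B2 -> B3).
Hypotheses (subK1 : submodule K1) (subK2 : submodule K2).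
Hypotheses (lin_phi : is_linear phi) (lin_psi : is_linear psi).
Hypothesis phiK : forall x, K1 x -> K2 (phi x).
Hypothesis pure : pure_ses (B1 := lmod_mops B1) (B2 := lmod_mops B2)
  (B3 := lmod_mops B3) K1 (fun x => x = 0) K2 (fun x => x = 0)
  K3 (fun x => x = 0) phi psi.

Section TestModule.
Variables (p q : nat) (a : 'I_p -> 'I_q -> S).

(** The right submodule of $S^p$ spanned by the columns of [a]; right scalars act through the
    opposite ring [S^c]. *)
Definition colspan (v : 'rV[S^c]_p) : Prop :=
  exists w : 'I_q -> S, forall i, (v 0 i : S) = \sum_j a i j * w j.

Lemma colspan0 : colspan 0.
Proof. by exists (fun=> 0) => i; rewrite mxE big1 // => j _; rewrite mulr0. Qed.
Lemma colspanB x y : colspan x -> colspan y -> colspan (x - y).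
Proof.
move=> [w Hw] [w' Hw']; exists (fun j => w j - w' j) => i.
rewrite !mxE Hw Hw' -sumrB; apply: eq_bigr => j _; by rewrite mulrBr.
Qed.
Lemma colspanZ (r : S^c) x : colspan x -> colspan (r *: x).
Proof.
move=> [w Hw]; exists (fun j => w j * (r : S)) => i; rewrite mxE.
transitivity ((x 0 i : S) * (r : S)) => //; rewrite Hw mulr_suml.
by apply: eq_bigr => j _; rewrite mulrA.
Qed.

Let mlaws := setoid_zmod_sub colspan0 colspanB.
Let mslaws := setoid_scale_sub colspan0 colspanZ.

(* The right module presented by the transpose of the system. *)
Definition transpose_mod : lmodType S^c := quot_lmod mlaws mslaws.

Definition solvable (v : {ffun 'I_p -> B1}) : Prop :=
  exists w : 'I_q -> B1, (forall j, K1 (w j)) /\ forall i, v i = \sum_j a i j *: w j.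

Lemma solvable0 : solvable 0.
Proof.
exists (fun=> 0); split=> [j|i]; first exact: submod0.
by rewrite ffunE big1 // => j _; rewrite scaler0.
Qed.
Lemma solvableB x y : solvable x -> solvable y -> solvable (x - y).
Proof.
move=> [w [Kw Hw]] [w' [Kw' Hw']]; exists (fun j => w j - w' j).
split=> [j|i]; first exact: submodB.
rewrite !ffunE Hw Hw' -sumrB; apply: eq_bigr => j _; by rewrite scalerBr.
Qed.

Let glaws := setoid_zmod_sub solvable0 solvableB.
(** The group $B_1^p / a K_1^q$. It contains $K_1^p / a K_1^q$, which is the tensor product of
    [transpose_mod] with [K1]; the class of [v] vanishes exactly when the system with constants [v]
    is solvable in [K1]. *)
Definition obstruction : zmodType := quot_zmod glaws.

Let mpi := lpi mlaws mslaws.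
Let gpi := zpi glaws.

Definition test_vec (v : 'rV[S^c]_p) (x : B1) : obstruction :=
  gpi [ffun i => (v 0 i : S) *: x].

Lemma test_vec_eq v v' x : K1 x -> mpi v = mpi v' -> test_vec v x = test_vec v' x.
Proof.
move=> Kx /(lpiP mlaws mslaws) [w Hw]; apply/(zpiP glaws).
exists (fun j => w j *: x); split=> [j|i]; first exact: submodZ.
rewrite !ffunE -scalerBl; have := Hw i; rewrite !mxE => ->.
by rewrite scaler_suml; apply: eq_bigr => j _; rewrite scalerA.
Qed.

Definition test_map (m : transpose_mod) (x : B1) : obstruction :=
  test_vec (lrepr m) x.

Lemma test_mapE v x : K1 x -> test_map (mpi v) x = test_vec v x.
Proof. by move=> Kx; apply: test_vec_eq => //; exact: lreprK. Qed.

Lemma test_balanced :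
  balanced (B := lmod_mops B1) K1 (fun x => x = 0) test_map.
Proof.
split.
- move=> m m' b Kb; rewrite -(lreprK m) -(lreprK m').
  rewrite -lpiD !test_mapE // -zpiD; congr zpi.
  by apply/ffunP => i; rewrite !ffunE !mxE scalerDl.
- move=> m b b' _ _; rewrite /test_map /test_vec -zpiD; congr zpi.
  by apply/ffunP => i; rewrite !ffunE scalerDr.
- move=> r m b Kb; rewrite -(lreprK m) -lpiZ !test_mapE //; last exact: submodZ.
  by congr zpi; apply/ffunP => i; rewrite !ffunE !mxE /= scalerA.
- move=> m _ ->; rewrite /test_map /test_vec -(zpi0 glaws); congr zpi.
  by apply/ffunP => i; rewrite !ffunE scaler0.
Qed.

(** Let $e_i$ be the generators of [transpose_mod]. The tensor $\sum_i e_i \otimes v_i$ becomes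
    $\sum_j (\sum_i e_i a_{ij}) \otimes b_j = 0$ over [K2], hence vanishes over [K1] by purity. The
    balanced map [test_map] sends it to the class of [v], so this class is zero. *)
Lemma solvable_of_image (b : 'I_q -> B2) (v : 'I_p -> B1) :
  (forall j, K2 (b j)) -> (forall i, K1 (v i)) ->
  (forall i, phi (v i) = \sum_j a i j *: b j) ->
  exists w : 'I_q -> B1, (forall j, K1 (w j)) /\ forall i, v i = \sum_j a i j *: w j.
Proof.
move=> Kb Kv Hv.
pose e i : transpose_mod := mpi (delta_mx 0 i).
(* This combination of generators is the class of column [j] of [a]; the indicator of [j] witnesses
   that it lies in the column span. *)
have e0 j : \sum_i (@GRing.scale S^c transpose_mod (a i j) (e i)) = 0.
  transitivity (mpi (\row_i (a i j : S^c))).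
    rewrite [X in mpi X]row_sum_delta.
    rewrite (big_morph mpi (lpiD mlaws mslaws) (lpi0 mlaws mslaws)).
    by apply: eq_bigr => i _; rewrite /mpi lpiZ mxE.
  apply/(zpi_eq0 mlaws); rewrite subr0; exists (fun j' => (j' == j)%:R) => i.
  rewrite mxE (bigD1 j) //= eqxx mulr1 big1 ?addr0 // => j' /negPf ->.
  by rewrite mulr0.
have [_ /(_ transpose_mod) [inj _ _]] := pure.
pose s : seq (transpose_mod * lmod_mops B1) := [seq (e i, v i) | i <- enum 'I_p].
have Ks : @tens_el S transpose_mod (lmod_mops B1) K1 s by exact: tens_el_map.
have : teq (B := lmod_mops B2) K2 (fun x => x = 0) (@tmap _ _ (lmod_mops B1) (lmod_mops B2) phi s) [::].
  move=> G beta bal.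
  rewrite big_nil /tmap /s -map_comp big_map big_enum /=.
  under eq_bigr => i _.
    rewrite Hv (bal_sumr subK2 bal); last by move=> j; exact: submodZ.
    under eq_bigr do rewrite -(balZ bal) //.
    over.
  rewrite exchange_big big1 //= => j _.
  by rewrite -(bal_suml bal) // e0 (bal0l bal).
move/(inj s Ks)/(_ _ _ test_balanced).
rewrite big_nil /s big_map big_enum /= => H.
have : gpi [ffun i => v i] = 0.
  rewrite -[RHS]H.
  have -> : [ffun i => v i] = \sum_i [ffun k => (delta_mx 0 i : 'rV[S]_p) 0 k *: v i].
    apply/ffunP => k; rewrite sum_ffunE ffunE (bigD1 k) //= big1 => [|i ik].
      by rewrite ffunE mxE !eqxx scale1r addr0.
    by rewrite ffunE mxE eqxx (eq_sym k) (negPf ik) scale0r.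
  transitivity (\sum_i gpi [ffun k => (delta_mx 0 i : 'rV[S]_p) 0 k *: v i]).
    exact: (big_morph gpi (zpiD glaws) (zpi0 glaws)).
  by apply: eq_bigr => i _; rewrite test_mapE.
by move/(zpi_eq0 glaws); rewrite subr0 => -[w [Kw Hw]]; exists w; split=> // i; rewrite -Hw ffunE.
Qed.

End TestModule.

(** In other words, a map from a finitely presented module to [K3] lifts to [K2]. For arbitrary
    lifts of the [c j] the relations fail by elements coming from [K1]; by [solvable_of_image] these
    defects are values of the same system on some [w j] in [K1], whose images are subtracted. *)
Lemma pure_ses_lift (p q : nat) (a : 'I_p -> 'I_q -> S) (c : 'I_q -> B3) :
  (forall j, K3 (c j)) -> (forall i, \sum_j a i j *: c j = 0) ->
  exists b : 'I_q -> B2, [/\ forall j, K2 (b j), forall j, psi (b j) = c j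
    & forall i, \sum_j a i j *: b j = 0].
Proof.
move=> Kc ac0; have [[_ mid sur] _] := pure.
have sur' z : K3 z -> exists y, K2 y /\ psi y = z.
  by move=> /sur [y [Ky /subr0_eq e]]; exists y.
have {}mid y : K2 y -> psi y = 0 -> exists x, K1 x /\ phi x = y.
  move=> Ky ey; have [mid1 _] := mid _ Ky.
  have [|x [Kx /subr0_eq ex]] := mid1; last by exists x.
  by rewrite /sq_eq /= ey subrr.
have [b0 Hb0] := choice (fun j => sur' _ (Kc j)).
have Kab i : K2 (\sum_j a i j *: b0 j).
  by apply: submod_sum => // j; apply: submodZ => //; case: (Hb0 j).
have pab i : psi (\sum_j a i j *: b0 j) = 0.
  rewrite islin_sum // -[RHS](ac0 i).
  by apply: eq_bigr => j _; rewrite islinZ // (Hb0 j).2.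
have [v Hv] := choice (fun i => mid _ (Kab i) (pab i)).
have [w [Kw Hw]] := solvable_of_image (fun j => (Hb0 j).1) (fun i => (Hv i).1) (fun i => (Hv i).2).
exists (fun j => b0 j - phi (w j)); split=> [j|j|i].
- by apply: submodB => //; [exact: (Hb0 j).1|exact: phiK].
- rewrite islinB // (Hb0 j).2; suff -> : psi (phi (w j)) = 0 by rewrite subr0.
  have [[_ mid' _] _] := pure.
  apply/subr0_eq; apply/(mid' (phi (w j)) (phiK (Kw j))).
  by exists (w j); split=> //; rewrite /sq_eq /= subrr.
- under eq_bigr do rewrite scalerBr; rewrite sumrB -(Hv i).2 Hw islin_sum //.
  by under eq_bigr do rewrite islinZ //; rewrite subrr.
Qed.

End SystemLift.

(** * From linear systems to purity: injectivity after tensoring *)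

(** The classical criterion for a pure submodule: a finite system with constants in [K1] and a
    solution in [K2] has a solution in [K1]. *)
Definition pure_sub (S : pzRingType) (B : lmodType S) (K1 K2 : B -> Prop) : Prop :=
  forall (p q : nat) (a : 'I_p -> 'I_q -> S) (c : 'I_q -> B),
    (forall j, K2 (c j)) -> (forall i, K1 (\sum_j a i j *: c j)) ->
    exists c' : 'I_q -> B, (forall j, K1 (c' j)) /\
      forall i, \sum_j a i j *: c' j = \sum_j a i j *: c j.

Lemma sum_enum_val (V : zmodType) (I : finType) (F : I -> V) :
  \sum_(k < #|I|) F (enum_val k) = \sum_i F i.
Proof. by rewrite (reindex _ (onW_bij _ (@enum_val_bij I))). Qed.

Lemma sum_enum_rank (V : zmodType) (I : finType) (F : 'I_#|I| -> V) :
  \sum_i F (enum_rank i) = \sum_k F k.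
Proof. by rewrite (reindex _ (onW_bij _ (@enum_rank_bij I))). Qed.

Lemma pure_sub_fin (S : pzRingType) (B : lmodType S) (K1 K2 : B -> Prop)
    (J I : finType) (a : J -> I -> S) (c : I -> B) :
  pure_sub K1 K2 ->
  (forall j, K2 (c j)) -> (forall i, K1 (\sum_j a i j *: c j)) ->
  exists c' : I -> B, (forall j, K1 (c' j)) /\
    forall i, \sum_j a i j *: c' j = \sum_j a i j *: c j.
Proof.
move=> pK K2c K1c.
have [||c' [K1c' e]] := pK #|J| #|I| (fun i j => a (enum_val i) (enum_val j))
  (fun j => c (enum_val j)).
- by move=> j; exact: K2c.
- move=> i; rewrite (sum_enum_val (fun j => a (enum_val i) j *: c j)); exact: K1c.
exists (fun j => c' (enum_rank j)); split=> [j|i]; first exact: K1c'.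
have := e (enum_rank i); rewrite enum_rankK.
rewrite (sum_enum_val (fun j => a i j *: c j)) => <-.
rewrite -(sum_enum_rank (fun k => a i (enum_val k) *: c' k)).
by apply: eq_bigr => j _; rewrite enum_rankK.
Qed.

Section TensorInjective.
Variables (S : pzRingType) (B : lmodType S) (K1 K2 : B -> Prop).
Hypotheses (subK1 : submodule K1) (subK2 : submodule K2).
Hypothesis pure : pure_sub K1 K2.

Definition seq_ext (s : seq B) (F : seq_sub s -> B) (x : B) : B :=
  if insub x is Some v then F v else 0.

(** Evaluation at [x] is a combination of the values of [F] with coefficients 0 and 1, so linear
    relations among values of an unknown map can be entered in a matrix. *)
Lemma sum_seq_ext (s : seq B) (F : seq_sub s -> B) x :
  \sum_v (val v == x)%:R *: F v = seq_ext F x.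
Proof.
rewrite /seq_ext; case: insubP => [u _ <-|xs].
  rewrite (bigD1 u) //= eqxx scale1r big1 ?addr0 // => v vu.
  by rewrite val_eqE (negPf vu) scale0r.
rewrite big1 // => v _; case: eqP => [vx|]; last by rewrite scale0r.
by rewrite -vx (valP v) in xs.
Qed.

Lemma seq_ext_val (s : seq B) (F : seq_sub s -> B) x (xs : x \in s) :
  seq_ext F x = F (Sub x xs).
Proof.
rewrite /seq_ext; case: insubP => [u _ ux|]; last by rewrite xs.
by congr F; apply: val_inj; rewrite /= -ux.
Qed.

(* A pure submodule is a retract as far as any finite list [i] of linear
   relations can see. *)
Lemma local_retraction (i : seq (S * B * B)) : exists l : B -> B,
  (forall b, K1 (l b)) /\
  forall r b b', (r, b, b') \in i -> K2 b -> K2 b' ->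
    l (r *: b + b') = r *: l b + l b' /\ (K1 b -> l b = b).
Proof.
pose rel (t : S * B * B) := t.1.1 *: t.1.2 + t.2.
pose s := flatten [seq [:: t.1.2; t.2; rel t] | t <- i].
pose c (v : seq_sub s) := if `[< K2 (val v) >] then val v else 0.
(* The unknowns are the values of the retraction on [s]. A row [inl t] asks for compatibility with
   the combination [t], a row [inr u] for fixing [u] when it lies in [K1]; rows about elements
   outside [K2] are zero. The inclusion [c] solves the system in [K2], with constants in [K1]. *)
pose a (j : seq_sub i + seq_sub s) (v : seq_sub s) : S := match j with
  | inl t => if `[< K2 (val t).1.2 /\ K2 (val t).2 >] then
      (val v == rel (val t))%:R - (val t).1.1 * (val v == (val t).1.2)%:R
      - (val v == (val t).2)%:R else 0
  | inr u => if `[< K1 (val u) /\ K2 (val u) >] then (val v == val u)%:R else 0 end.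
have suma (F : seq_sub s -> B) (t : seq_sub i) : K2 (val t).1.2 -> K2 (val t).2 ->
    \sum_v a (inl t) v *: F v = seq_ext F (rel (val t))
      - (val t).1.1 *: seq_ext F (val t).1.2 - seq_ext F (val t).2.
  move=> Kb Kb'; rewrite -!sum_seq_ext scaler_sumr -!sumrB; apply: eq_bigr => v _.
  by rewrite /= asboolT // !scalerBl scalerA.
have extc x : K2 x -> x \in s -> seq_ext c x = x.
  by move=> Kx xs; rewrite (seq_ext_val _ xs) /c /= asboolT.
have ins r b b' : (r, b, b') \in i -> [/\ b \in s, b' \in s & r *: b + b' \in s].
  by move=> ti; split; apply/flatten_mapP; exists (r, b, b') => //; rewrite !inE eqxx ?orbT.
have [||c' [K1c' e]] := pure_sub_fin (a := a) (c := c) pure.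
- by move=> v; rewrite /c; case: asboolP => // _; exact: submod0.
- case=> [t|u].
    case: (pselect (K2 (val t).1.2 /\ K2 (val t).2)) => [[Kb Kb']|nK]; last first.
      by rewrite big1 => [|v _]; [exact: submod0|rewrite /= asboolF // scale0r].
    rewrite suma //; case: t Kb Kb' => -[[r b] b'] ti /= Kb Kb'.
    have [bs bs' xs] := ins _ _ _ ti.
    rewrite !extc //; last by apply: subK2.2.
    by rewrite /rel /= -addrA -opprD subrr; exact: submod0.
  case: (pselect (K1 (val u) /\ K2 (val u))) => [[Kb Kb']|nK]; last first.
    by rewrite big1 => [|v _]; [exact: submod0|rewrite /= asboolF // scale0r].
  rewrite /= asboolT // sum_seq_ext extc //; exact: valP.
exists (seq_ext c'); split=> [b|r b b' ti Kb Kb'].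
  by rewrite /seq_ext; case: insub => [v|]; [exact: K1c'|exact: submod0].
have [bs bs' xs] := ins _ _ _ ti; split=> [|K1b].
  have := e (inl (SeqSub ti)); rewrite !suma //= !extc //; last by apply: subK2.2.
  by rewrite /rel /= -[RHS]addrA -[LHS]addrA -!opprD subrr => /subr0_eq.
have := e (inr (SeqSub bs)); rewrite /= asboolT // !sum_seq_ext => ->.
exact: extc.
Qed.

(** * Reduced powers along the filter of large finite lists *)

Section ReducedPower.
Variables (I : eqType) (G : zmodType).

(** Lists are directed by inclusion of their elements. Any finite set of linear relations can be put
    in a list, so laws that hold only for sufficiently large lists become identities in the
    quotient. *)
Definition eventually_eq (u v : seq I -> G) : Prop :=
  exists i0 : seq I, forall i, {subset i0 <= i} -> u i = v i.

Lemma reduced_power_setoid :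
  setoid_zmod (fun=> 0) (fun u v i => u i + v i) (fun u i => - u i) eventually_eq.
Proof.
have sub_catl (s t i : seq I) : {subset s ++ t <= i} -> {subset s <= i}.
  by move=> sti x xs; apply: sti; rewrite mem_cat xs.
have sub_catr (s t i : seq I) : {subset s ++ t <= i} -> {subset t <= i}.
  by move=> sti x xs; apply: sti; rewrite mem_cat xs orbT.
split.
- by move=> x y [i0 H]; exists i0 => i /H.
- move=> x y z [i0 H] [i1 H']; exists (i0 ++ i1) => i ii.
  by rewrite H ?H' //; [exact: sub_catr ii|exact: sub_catl ii].
- move=> x x' y y' [i0 H] [i1 H']; exists (i0 ++ i1) => i ii.
  by rewrite H ?H' //; [exact: sub_catr ii|exact: sub_catl ii].
- by move=> x x' [i0 H]; exists i0 => i /H ->.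
- by move=> x y z; exists [::] => i _; rewrite addrA.
- by move=> x y; exists [::] => i _; rewrite addrC.
- by move=> x; exists [::] => i _; rewrite add0r.
- by move=> x; exists [::] => i _; rewrite addNr.
Qed.

Definition reduced_power : zmodType := quot_zmod reduced_power_setoid.
Definition rpi : (seq I -> G) -> reduced_power := zpi reduced_power_setoid.

Lemma rpi_sum (T : Type) (r : seq T) (F : T -> seq I -> G) :
  \sum_(t <- r) rpi (F t) = rpi (fun i => \sum_(t <- r) F t i).
Proof.
elim: r => [|t r IH].
  by rewrite big_nil; apply/esym/zpi_eq0; exists [::] => i _; rewrite big_nil.
rewrite big_cons IH -zpiD; apply/zpiP; exists [::] => i _; by rewrite big_cons.
Qed.

End ReducedPower.

(* Local retractions assemble into a genuine linear map from K2 to a reduced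
   power of K1 that extends the diagonal, so a balanced map on K1 extends to K2
   after enlarging its target to the reduced power. *)
Lemma teq_pure_sub (M : lmodType S^c) (x : seq (M * B)) :
  (forall b, K1 b -> K2 b) ->
  tens_el (B := lmod_mops B) K1 x ->
  teq (B := lmod_mops B) K2 (fun b => b = 0) x [::] ->
  teq (B := lmod_mops B) K1 (fun b => b = 0) x [::].
Proof.
move=> K12 Kx H G beta bal; rewrite big_nil.
have [l Hl] := choice local_retraction.
have K1l i b : K1 (l i b) by case: (Hl i).
have lE i r b b' : (r, b, b') \in i -> K2 b -> K2 b' ->
    l i (r *: b + b') = r *: l i b + l i b' /\ (K1 b -> l i b = b).
  by case: (Hl i) => _; apply.
have K20 := submod0 subK2; have K10 := submod0 subK1.
have l0 i : (1, 0, 0) \in i -> l i 0 = 0 by move=> /lE [] // _; apply.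
pose beta' m b := rpi (fun i => beta m (l i b)).
have bal' : balanced (B := lmod_mops B) K2 (fun b => b = 0) beta'.
  split.
  - move=> m m' b Kb; rewrite /beta' -zpiD; apply/zpiP; exists [::] => i _.
    by rewrite (balDl bal).
  - move=> m b b' Kb Kb'; rewrite /beta' -zpiD; apply/zpiP.
    exists [:: (1, b, b')] => i /(_ _ (mem_head _ _)) /lE [] // e _.
    by rewrite -(balDr bal) //; congr beta; move: e; rewrite !scale1r.
  - move=> r m b Kb; apply/zpiP; exists [:: (r, b, 0); (1, 0, 0)] => i ii.
    rewrite (balZ bal) //; congr beta; apply/esym.
    have /lE [] // : (r, b, 0) \in i by apply: ii; rewrite mem_head.
    by rewrite addr0 l0 ?addr0 //; apply: ii; rewrite !inE eqxx orbT.
  - move=> m _ ->; apply/zpi_eq0; exists [:: (1, 0, 0)] => i /(_ _ (mem_head _ _)) /l0 ->.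
    exact: (bal0r subK1 bal).
have := H _ _ bal'; rewrite big_nil rpi_sum => /zpi_eq0 [i0 Hi0].
(* This list is large enough for the vanishing in the reduced power, and it mentions every second
   component of [x], so that [l i] fixes all of them. *)
pose i := i0 ++ [seq ((1, p.2, 0) : S * B * B) | p <- x].
rewrite -[RHS](Hi0 i); last by move=> t ti; rewrite /i mem_cat ti.
apply: (@eq_big_seq _ _ _ (M * B)%type) => p px.
have pi : (1, p.2, 0) \in i by rewrite mem_cat; apply/orP; right; apply/mapP; exists p.
have Kp : K1 p.2.
  elim: {+}x Kx px => //= p' x' IH [Kp' Kx'] /[!inE] /orP[/eqP -> //|]; exact: IH.
by have [//||_ ->] := lE _ _ _ _ pi; first exact: K12.
Qed.

End TensorInjective.

(** * From linear systems to purity: exact complexes *)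

Lemma tens_el_cat (S : pzRingType) (M : lmodType S^c) (B : mops S) (K : B -> Prop)
    (s t : seq (M * B)) :
  tens_el K s -> tens_el K t -> tens_el K (s ++ t).
Proof. by elim: s => //= p s IH [Kp Ks] Kt; split=> //; exact: IH. Qed.

Lemma tmap_id (S : pzRingType) (M : lmodType S^c) (B : mops S) (x : seq (M * B)) :
  tmap id x = x.
Proof. by rewrite /tmap -[RHS]map_id; apply: eq_map => -[]. Qed.

(** * Right exactness of the tensor product *)

Section RightExact.
Variables (S : pzRingType) (B B3 : lmodType S) (K1 K2 : B -> Prop).
Variables (K3 Q3 : B3 -> Prop) (psi : B -> B3).
Hypothesis subK2 : submodule K2.
Hypotheses (subK3 : submodule K3) (subQ3 : submodule Q3).
Hypothesis K12 : forall b, K1 b -> K2 b.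
Hypothesis Q3K3 : forall b, Q3 b -> K3 b.
Hypothesis lin : is_linear psi.
Hypothesis psiK : forall b, K2 b -> K3 (psi b).
Hypothesis ex_mid : forall b, K2 b -> Q3 (psi b) <-> K1 b.
Hypothesis ex_sur : forall z, K3 z -> exists2 b, K2 b & Q3 (psi b - z).
Variable M : lmodType S^c.

Let zeroB (b : B) : Prop := b = 0.

Lemma sumN_bal (K Q : B -> Prop) (G : zmodType) (beta : M -> B -> G) (x : seq (M * B)) :
  balanced (B := lmod_mops B) K Q beta -> tens_el (B := lmod_mops B) K x ->
  \sum_(p <- [seq (- p.1, p.2) | p <- x]) beta p.1 p.2 = - \sum_(p <- x) beta p.1 p.2.
Proof.
move=> bal; elim: x => [|p x IH] /=; first by rewrite !big_nil oppr0.
by case=> Kp Kx; rewrite !big_cons IH //= (balNl bal) // opprD.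
Qed.

Lemma tens_elN (K : B -> Prop) (x : seq (M * B)) :
  tens_el (B := lmod_mops B) K x ->
  tens_el (B := lmod_mops B) K [seq (- p.1, p.2) | p <- x].
Proof. by elim: x => //= p x IH [Kp /IH]. Qed.

Let T := seq (M * {b | K2 b}).
Let tv (s : T) : seq (M * B) := [seq (p.1, sval p.2) | p <- s].

Let tvK (s : T) : tens_el (B := lmod_mops B) K2 (tv s).
Proof. by elim: s => //= p s IH; split=> //; exact: svalP. Qed.

Let tens1 (K : B -> Prop) (m : M) b : K b -> tens_el (B := lmod_mops B) K [:: (m, b)].
Proof. by []. Qed.

(** The quotient by this relation is the cokernel of the map from the tensors over [K1] to those
    over [K2]; [x] is the tensor over [K1] by which [s] and [t] differ. *)
Definition eq_mod_sub (s t : T) : Prop :=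
  exists2 x : seq (M * B), tens_el (B := lmod_mops B) K1 x &
    forall (G : zmodType) (beta : M -> B -> G),
      balanced (B := lmod_mops B) K2 zeroB beta ->
      \sum_(p <- x) beta p.1 p.2 + \sum_(p <- tv t) beta p.1 p.2
      = \sum_(p <- tv s) beta p.1 p.2.

Let tens12 x : tens_el (B := lmod_mops B) K1 x ->
  @tens_el _ M (lmod_mops B) K2 x.
Proof. by elim: x => //= p x IH [Kp /IH]; split=> //; exact: K12. Qed.

Let tv_cat s t : tv (s ++ t) = tv s ++ tv t. Proof. exact: map_cat. Qed.

Let topp (s : T) : T := [seq (- p.1, p.2) | p <- s].

Let tv_opp s : tv (topp s) = [seq (- p.1, p.2) | p <- tv s].
Proof. by rewrite /tv /topp -!map_comp. Qed.

Lemma eq_mod_sub_setoid : setoid_zmod ([::] : T) cat topp eq_mod_sub.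
Proof.
have E0 s t : (forall (G : zmodType) (beta : M -> B -> G),
      balanced (B := lmod_mops B) K2 zeroB beta ->
      \sum_(p <- tv t) beta p.1 p.2 = \sum_(p <- tv s) beta p.1 p.2) -> eq_mod_sub s t.
  by move=> H; exists [::] => // G beta /H; rewrite big_nil add0r.
split.
- move=> s t [x Kx H]; exists [seq (- p.1, p.2) | p <- x]; first exact: tens_elN.
  by move=> G beta bal; rewrite -H // (sumN_bal bal) ?addKr //; exact: tens12.
- move=> s t u [x Kx H] [x' Kx' H']; exists (x ++ x'); first exact: tens_el_cat.
  by move=> G beta bal; rewrite -H // -H' // big_cat addrA.
- move=> s s' t t' [x Kx H] [x' Kx' H']; exists (x ++ x'); first exact: tens_el_cat.
  by move=> G beta bal; rewrite !tv_cat !big_cat /= -H // -H' // addrACA.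
- move=> s t [x Kx H]; exists [seq (- p.1, p.2) | p <- x]; first exact: tens_elN.
  move=> G beta bal; rewrite !tv_opp !(sumN_bal bal) //; last exact: tens12.
  by rewrite -H // opprD.
- by move=> s t u; apply: E0 => G beta bal; rewrite catA.
- by move=> s t; apply: E0 => G beta bal; rewrite !tv_cat !big_cat /= addrC.
- by move=> s; apply: E0.
- move=> s; apply: E0 => G beta bal; rewrite tv_cat big_cat /= tv_opp.
  by rewrite (sumN_bal bal) // addNr big_nil.
Qed.

Let tpi := zpi eq_mod_sub_setoid.

Let tpiP (s t : T) (x : seq (M * B)) : tens_el (B := lmod_mops B) K1 x ->
  (forall (G : zmodType) (beta : M -> B -> G),
      balanced (B := lmod_mops B) K2 zeroB beta ->
      \sum_(p <- x) beta p.1 p.2 + \sum_(p <- tv t) beta p.1 p.2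
      = \sum_(p <- tv s) beta p.1 p.2) -> tpi s = tpi t.
Proof. by move=> Kx H; apply/zpiP; exists x. Qed.

Lemma lift_exists :
  exists g : B3 -> B, (forall z, K2 (g z)) /\ forall z, K3 z -> Q3 (psi (g z) - z).
Proof.
have [g Hg] : {g : B3 -> B & forall z, K2 (g z) /\ (K3 z -> Q3 (psi (g z) - z))}.
  apply: (@choice B3 B (fun z y => K2 y /\ (K3 z -> Q3 (psi y - z)))) => z.
  have [/ex_sur [b Kb Qb]|nK] := pselect (K3 z); first by exists b.
  by exists 0; split=> //; exact: submod0.
by exists g; split=> z; case: (Hg z).
Qed.

Section Lifting.
Variables (g : B3 -> B) (Kg : forall z, K2 (g z)).
Hypothesis Qg : forall z, K3 z -> Q3 (psi (g z) - z).

Let beta3 (m : M) (z : B3) := tpi [:: (m, exist _ (g z) (Kg z))].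

(** The section [g] need not be linear, but its defects of linearity are sent into [Q3], so by
    exactness they lie in [K1] and vanish in the cokernel. The resulting map is the inverse of the
    one induced by [psi] on the cokernel. *)
Lemma lifting_balanced : balanced (B := lmod_mops B3) K3 Q3 beta3.
Proof.
split.
- move=> m m' z Kz; rewrite /beta3 -zpiD; apply: (@tpiP _ _ [::]) => // G beta bal.
  by rewrite /= !big_cons !big_nil /= !addr0 add0r (balDl bal).
- move=> m z z' Kz Kz'; rewrite /beta3 -zpiD.
  apply: (@tpiP _ _ [:: (m, g (z + z') - (g z + g z'))]).
    apply: tens1; apply/ex_mid; first by apply: submodB => //; exact: submodD.
    rewrite (islinB lin) (islinD lin).
    rewrite -(subrKA (z + z')); apply: submodD => //; first by apply: Qg; exact: submodD.
    rewrite -opprB; apply: submodN => //.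
    by rewrite opprD addrACA; apply: submodD => //; exact: Qg.
  move=> G beta bal; rewrite /= !big_cons !big_nil /= !addr0.
  rewrite -!(balDr bal) // ?subrK //; first by apply: submodB => //; exact: submodD.
  exact: submodD.
- move=> r m z Kz; apply: (@tpiP _ _ [:: (m, r *: g z - g (r *: z))]).
    apply: tens1; apply/ex_mid; first by apply: submodB => //; exact: submodZ.
    rewrite (islinB lin) (islinZ lin) -(subrKA (r *: z)); apply: submodD => //.
      by rewrite -scalerBr; apply: submodZ => //; exact: Qg.
    by rewrite -opprB; apply: submodN => //; apply: Qg; exact: submodZ.
  move=> G beta bal; rewrite /= !big_cons !big_nil /= !addr0 (balZ bal) //.
  rewrite -(balDr bal) // ?subrK //; apply: submodB => //; exact: submodZ.
- move=> m z Qz; apply: (@tpiP _ [::] [:: (m, g z)]).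
    apply: tens1; apply/ex_mid => //; rewrite -(subrK z (psi _)).
    by apply: submodD => //; apply: Qg; exact: Q3K3.
  by move=> G beta bal; rewrite /= !big_cons !big_nil /= !addr0.
Qed.

Lemma lift_diff b : K2 b -> K1 (b - g (psi b)).
Proof.
move=> Kb; apply/ex_mid; first exact: submodB.
by rewrite (islinB lin) -opprB; apply: submodN => //; apply/Qg/psiK.
Qed.

(** Applying the hypothesis to the lifting map shows that the tensor of the elements [g (psi b)]
    comes from [K1]. The differences [b - g (psi b)] lie in [K1] as well, and adding them back
    recovers [y]. *)
Lemma tensor_exact_mid y : tens_el (B := lmod_mops B) K2 y ->
  teq (B := lmod_mops B3) K3 Q3 (@tmap _ M (lmod_mops B) (lmod_mops B3) psi y) [::] ->
  exists x, tens_el (B := lmod_mops B) K1 x /\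
    teq (B := lmod_mops B) K2 zeroB (@tmap _ M (lmod_mops B) (lmod_mops B) id x) y.
Proof.
move=> Ky /(_ _ _ lifting_balanced); rewrite big_nil big_map /=.
rewrite -(big_morph tpi (zpiD eq_mod_sub_setoid) (zpi0 eq_mod_sub_setoid)).
move/zpi_eq0 => [x Kx Hx].
exists (x ++ [seq (p.1, p.2 - g (psi p.2)) | p <- y]); split.
  apply: tens_el_cat => //.
  by elim: {Hx} y Ky => //= p y IH [Kp /IH]; split=> //; exact: lift_diff.
move=> G beta bal; have := Hx _ _ bal; rewrite tmap_id big_cat big_nil addr0 /= => ->.
rewrite big_map.
elim: {Hx} y Ky => [|p y IH] /=; first by rewrite !big_nil addr0.
case=> Kp Ky; rewrite !big_cons /= addrACA IH //; congr (_ + _).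
by rewrite -(balDr bal) ?subrKC //; exact: submodB.
Qed.

Lemma tensor_exact_sur z : tens_el (B := lmod_mops B3) K3 z -> exists y,
    tens_el (B := lmod_mops B) K2 y /\
    teq (B := lmod_mops B3) K3 Q3 (@tmap _ M (lmod_mops B) (lmod_mops B3) psi y) z.
Proof.
move=> Kz; exists [seq (p.1, g p.2) | p <- z]; split.
  by elim: z {Kz} => //= p z IH; split.
move=> G beta bal; rewrite /tmap -map_comp big_map.
elim: z Kz => [|p z IH] /=; first by rewrite !big_nil.
case=> Kp Kz; rewrite !big_cons IH //; congr (_ + _) => /=.
rewrite -(subrK p.2 (psi _)) (balDr bal) //; last exact/Q3K3/Qg.
by case: bal => _ _ _ ->; rewrite ?add0r //; exact: Qg.
Qed.

End Lifting.

Lemma tensor_comp_zero (x y : seq (M * B)) :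
  tens_el (B := lmod_mops B) K1 x -> tens_el (B := lmod_mops B) K2 y ->
  teq (B := lmod_mops B) K2 zeroB x y ->
  teq (B := lmod_mops B3) K3 Q3 (@tmap _ M (lmod_mops B) (lmod_mops B3) psi y) [::].
Proof.
move=> Kx Ky xy G beta bal; rewrite big_nil big_map.
have bal2 : balanced (B := lmod_mops B) K2 zeroB (fun m b => beta m (psi b)).
  split=> [m m' b Kb|m b b' Kb Kb'|r m b Kb|m _ ->] /=.
  - by rewrite (balDl bal) //; exact: psiK.
  - by rewrite (islinD lin) (balDr bal) //; exact: psiK.
  - by rewrite (islinZ lin) (balZ bal) //; exact: psiK.
  - by rewrite (islin0 lin) (bal0r subK3 bal).
have := xy _ _ bal2; rewrite /= => <-.
elim: {xy} x Kx => [|p x IH] /=; first by rewrite big_nil.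
case=> Kp Kx; rewrite big_cons IH // addr0; case: bal => _ _ _; apply.
by apply/ex_mid => //; exact: K12.
Qed.

End RightExact.

(** Purity of [K1] gives injectivity after tensoring; exactness in the middle and on the right is
    right exactness of the tensor product. *)
Lemma pure_ses_of_pure_sub (S : pzRingType) (B B3 : lmodType S) (K1 K2 : B -> Prop)
    (K3 Q3 : B3 -> Prop) (psi : B -> B3) :
  submodule K1 -> submodule K2 -> submodule K3 -> submodule Q3 ->
  (forall b, K1 b -> K2 b) -> (forall b, Q3 b -> K3 b) -> is_linear psi ->
  (forall b, K2 b -> K3 (psi b)) -> (forall b, K2 b -> Q3 (psi b) <-> K1 b) ->
  (forall z, K3 z -> exists2 b, K2 b & Q3 (psi b - z)) ->
  pure_sub K1 K2 ->
  pure_ses (B1 := lmod_mops B) (B2 := lmod_mops B) (B3 := lmod_mops B3)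
    K1 (fun x => x = 0) K2 (fun x => x = 0) K3 Q3 id psi.
Proof.
move=> s1 s2 s3 sq K12 Q3K3 lin psiK mid sur pure; split.
  split=> /=.
  - by move=> x _; rewrite /sq_eq.
  - move=> y Ky; rewrite /sq_eq /= subr0 mid //; split=> [K1y|[x [K1x /subr0_eq <- //]]].
    by exists y; split=> //; rewrite subrr.
  - by move=> z /sur [b Kb Qb]; exists b.
move=> M.
have [g [Kg Qg]] := lift_exists s2 sur.
split.
- by move=> x Kx; rewrite tmap_id; exact: teq_pure_sub.
- move=> y Ky; split; first exact: (tensor_exact_mid s2 s3 sq K12 Q3K3 lin psiK mid Kg Qg).
  by case=> x [Kx]; rewrite tmap_id => xy; exact: (tensor_comp_zero s3 K12 lin psiK mid Kx Ky xy).
- by move=> z Kz; exact: (tensor_exact_sur Q3K3 Kg Qg Kz).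
Qed.

(** * A lifting criterion for pure exactness of a complex *)

Section RawPureExact.
Variables (S : pzRingType) (B : int -> lmodType S) (A : forall n, B n -> Prop).
Variable d : forall n, B n -> B (n + 1).
Hypotheses (subA : forall n, submodule (@A n)) (lin : forall n, is_linear (@d n)).
Hypothesis dA : forall n x, A x -> A (@d n x).
Hypothesis dd : forall n x, A x -> d (@d n x) = 0.
Hypothesis lift : forall n (p q : nat) (a : 'I_p -> 'I_q -> S) (y : 'I_q -> B (n + 1)),
  (forall j, A (y j)) -> (forall j, d (y j) = 0) ->
  (forall i, \sum_j a i j *: y j = 0) ->
  exists x : 'I_q -> B n, [/\ forall j, A (x j), forall j, d (x j) = y j
    & forall i, \sum_j a i j *: x j = 0].

Let ker n (x : B n) := A x /\ d x = 0.
Let im n (y : B (n + 1)) := exists x, A x /\ d x = y.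

Let sub_ker n : submodule (@ker n).
Proof.
split; first by split; [exact: submod0|exact: islin0].
move=> a x y [Ax dx] [Ay dy]; split; first by apply: (subA n).2.
by rewrite lin dx dy scaler0 addr0.
Qed.

Let im_ker n : @im n = @ker (n + 1).
Proof.
apply: funext => y; apply: propext; split=> [[x [Ax <-]]|[Ay dy]].
  by split; [exact: dA|exact: dd].
(* One unknown and no relation: the lifting hypothesis contains plain exactness. *)
have [|||x [Ax dx _]] := @lift n 0 1 (fun _ _ => 0) (fun=> y) => //; last first.
  by exists (x ord0).
by case.
Qed.

(** The elements [d (c j)] satisfy the relations of [a], hence have primitives that satisfy them
    too; subtracting these from the [c j] gives cocycles with the same combinations. *)
Let pure_ker n : pure_sub (@ker n) (@A n).
Proof.
move=> p q a c Ac Kc.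
have [|||x [Ax dx ax]] := lift (a := a) (y := fun j => d (c j)).
- by move=> j; exact: dA.
- by move=> j; exact: dd.
- move=> i; rewrite -[RHS](Kc i).2 (islin_sum (@lin n)).
  by apply: eq_bigr => j _; rewrite (islinZ (@lin n)).
exists (fun j => c j - x j); split=> [j|i].
  by split; [exact: submodB|rewrite (islinB (@lin n)) dx subrr].
by under eq_bigr do rewrite scalerBr; rewrite sumrB ax subr0.
Qed.

(** Images equal kernels, and kernels are pure submodules, so all three sequences begin with a pure
    submodule. *)
Lemma raw_pure_exact_of_lift :
  @raw_pure_exact S (fun n => lmod_mops (B n)) A d.
Proof.
move=> k; split.
- apply: (@pure_ses_of_pure_sub S (B k) (B (k + 1)) (@ker k) (@A k) (@im k) (fun x => x = 0)) => //.
  + by rewrite im_ker.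
  + by split=> // a x y -> ->; rewrite scaler0 addr0.
  + by move=> b [].
  + by move=> b ->; rewrite im_ker; exact: submod0.
  + by move=> b Ab; exists b.
  + by move=> b Ab; split=> [db|[]].
  + by move=> z [x [Ax dx]]; exists x => //; rewrite dx subrr.
- have sub_im : submodule (@im k) by rewrite im_ker.
  apply: (@pure_ses_of_pure_sub S (B (k + 1)) (B (k + 1)) (@im k) (@A (k + 1)) (@A (k + 1)) (@im k)) => //.
  + by rewrite im_ker => b [].
  + by rewrite im_ker => b [].
  + by move=> z Az; exists z => //; rewrite subrr; exact: submod0.
  + by rewrite im_ker.
- rewrite /pure_kercoker_at; have -> : @rim _ (fun n => lmod_mops (B n)) A d k = @ker (k + 1) by exact: im_ker.
  apply: (@pure_ses_of_pure_sub S (B (k + 1)) (B (k + 1)) (@ker (k + 1)) (@A (k + 1)) (@A (k + 1)) (@ker (k + 1))) => //.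
  + by move=> b [].
  + by move=> b [].
  + by move=> z Az; exists z => //; rewrite subrr; exact: submod0.
Qed.

End RawPureExact.

(** * The cellular resolution *)

Definition mklin (R : pzRingType) (U V : lmodType R) (h : U -> V) (lin : is_linear h) :
  {linear U -> V} := HB.pack_for {linear U -> V} h (GRing.isLinear.Build R U V *:%R h lin).

Lemma linear_is_linear (R : pzRingType) (U V : lmodType R) (h : {linear U -> V}) :
  is_linear h.
Proof. by move=> a u v; rewrite linearP. Qed.

Section Terms.
Variables (R : pzRingType) (X : complex R).

(** The attaching terms [z] of a cell are subterms one degree higher; constructions over all cells
    thus recurse on terms while degrees go up. *)
Inductive term (n : int) : Type :=
| tzero
| tadd of term n & term n
| topp of term n
| tscale of R & term n
| tgen (p q : nat) (a : 'I_p -> 'I_q -> R) (z : 'I_q -> term (n + 1))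
    (y : 'I_q -> obj X n) (k : 'I_q).

Arguments tzero {n}.

(* [term_ind] varies the degree; this principle keeps it fixed. *)
Definition term_degree_ind n (P : term n -> Prop) (P0 : P tzero)
    (PD : forall u, P u -> forall v, P v -> P (tadd u v))
    (PN : forall u, P u -> P (topp u)) (PZ : forall r u, P u -> P (tscale r u))
    (PG : forall p q a z y k, P (@tgen n p q a z y k)) : forall t, P t :=
  fix F t := match t with
  | tzero => P0
  | tadd u v => PD u (F u) v (F v)
  | topp u => PN u (F u)
  | tscale r u => PZ r u (F u)
  | tgen p q a z y k => PG p q a z y k
  end.

Definition interp (n : int) (L : lmodType R) := forall (p q : nat)
  (a : 'I_p -> 'I_q -> R) (z : 'I_q -> term (n + 1)) (y : 'I_q -> obj X n), 'I_q -> L.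

Definition good (n : int) (L : lmodType R) (g : interp n L) : Prop :=
  forall p q a z y i, \sum_k a i k *: g p q a z y k = 0.

Fixpoint ev (n : int) (L : lmodType R) (g : interp n L) (t : term n) : L :=
  match t with
  | tzero => 0
  | tadd u v => ev g u + ev g v
  | topp u => - ev g u
  | tscale r u => r *: ev g u
  | tgen p q a z y k => g p q a z y k
  end.

(** Two terms are identified when all interpretations respecting the relations of the cells agree on
    them. The quotient therefore has the universal property of the direct sum, over all
    [(p, q, a, z, y)], of the modules presented by [a]. *)
Definition teqv (n : int) (t t' : term n) : Prop :=
  forall (L : lmodType R) (g : interp n L), good g -> ev g t = ev g t'.

Lemma term_setoid n : setoid_zmod (@tzero n) (@tadd n) (@topp n) (@teqv n).
Proof.
split.
- by move=> x y H L g gg; rewrite H.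
- by move=> x y z H H' L g gg; rewrite H // H'.
- by move=> x x' y y' H H' L g gg /=; rewrite H // H'.
- by move=> x x' H L g gg /=; rewrite H.
- by move=> x y z L g gg /=; rewrite addrA.
- by move=> x y L g gg /=; rewrite addrC.
- by move=> x L g gg /=; rewrite add0r.
- by move=> x L g gg /=; rewrite addNr.
Qed.

Lemma term_scale n : setoid_scale (@tadd n) (@teqv n) (@tscale n).
Proof.
split.
- by move=> a x x' H L g gg /=; rewrite H.
- by move=> a b x L g gg /=; rewrite scalerA.
- by move=> x L g gg /=; rewrite scale1r.
- by move=> a x y L g gg /=; rewrite scalerDr.
- by move=> x a b L g gg /=; rewrite scalerDl.
Qed.

Definition res_obj n : lmodType R := quot_lmod (term_setoid n) (term_scale n).

Definition tpi n : term n -> res_obj n := lpi (term_setoid n) (term_scale n).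

Lemma tpiP n (t t' : term n) : tpi t = tpi t' <-> teqv t t'.
Proof. exact: lpiP. Qed.
Lemma tpi_repr n (x : res_obj n) : tpi (lrepr x) = x.
Proof. exact: lreprK. Qed.
Lemma repr_tpi n (t : term n) : teqv (lrepr (tpi t)) t.
Proof. exact: lreprP. Qed.

(* The cell described by [(a, z, y)] may be attached when [z] and [y] define a
   cocycle of the cone on the module presented by [a]; [dz] and [fz] are the
   values on [z] of the differential and of the map to [X]. *)
Definition valid n p q (a : 'I_p -> 'I_q -> R) (z : 'I_q -> term (n + 1))
    (y : 'I_q -> obj X n) (dz : 'I_q -> term (n + 1 + 1))
    (fz : 'I_q -> obj X (n + 1)) : Prop :=
  [/\ forall k, teqv (dz k) tzero,
      forall (L : lmodType R) (g : interp (n + 1) L), good g ->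
        forall i, \sum_k a i k *: ev g (z k) = 0,
      forall k, fz k = dif X n (y k)
    & forall i, \sum_k a i k *: y k = 0].

(* Cells that cannot be attached get zero differential and zero image, so that
   every raw term makes sense. *)
Fixpoint tdf n (t : term n) : term (n + 1) * obj X n :=
  match t with
  | tzero => (tzero, 0)
  | tadd u v => (tadd (tdf u).1 (tdf v).1, (tdf u).2 + (tdf v).2)
  | topp u => (topp (tdf u).1, - (tdf u).2)
  | tscale r u => (tscale r (tdf u).1, r *: (tdf u).2)
  | tgen p q a z y k =>
      if `[< valid a z y (fun k => (tdf (z k)).1) (fun k => (tdf (z k)).2) >]
      then (z k, y k) else (tzero, 0)
  end.

Notation td t := (tdf t).1.
Notation tf t := (tdf t).2.

Lemma ev_good_tpi n (L : lmodType R) (g : interp n L) t :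
  good g -> ev g (lrepr (tpi t)) = ev g t.
Proof. by move=> gg; exact: repr_tpi. Qed.

Lemma ev_linear n (L : lmodType R) (g : interp n L) : good g ->
  is_linear (fun x : res_obj n => ev g (lrepr x)).
Proof.
move=> gg a x y; rewrite -{1}(tpi_repr x) -{1}(tpi_repr y).
by rewrite /tpi -lpiZ -lpiD ev_good_tpi.
Qed.

Lemma linear_tpi n (L : lmodType R) (h : res_obj n -> L) (t : term n) : is_linear h ->
  h (tpi t) = ev (fun p q a z y k => h (tpi (tgen a z y k))) t.
Proof.
move=> lin; elim/term_degree_ind: t => //= [|u IHu v IHv|u IH|r u IH].
- exact: (islin0 lin).
- by rewrite -IHu -IHv -(islinD lin) /tpi lpiD.
- by rewrite -IH -(islinN lin) /tpi lpiN.
- by rewrite -IH -(islinZ lin) /tpi lpiZ.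
Qed.

Lemma linear_good n (L : lmodType R) (h : res_obj n -> L) : is_linear h ->
  good (fun p q a z y k => h (tpi (tgen a z y k))).
Proof.
move=> lin p q a z y i.
have sumE (M : lmodType R) (h' : res_obj n -> M) : is_linear h' ->
    h' (\sum_k a i k *: tpi (tgen a z y k)) = \sum_k a i k *: h' (tpi (tgen a z y k)).
  move=> lin'; rewrite (islin_sum lin'); apply: eq_bigr => k _.
  by rewrite (islinZ lin').
rewrite -sumE //.
suff -> : \sum_k a i k *: tpi (tgen a z y k) = 0 by exact: islin0.
rewrite -(tpi_repr (\sum_k _)); apply/tpiP => M g gg /=.
rewrite (sumE _ _ (ev_linear gg)) -[RHS](gg p q a z y i).
by apply: eq_bigr => k _; rewrite ev_good_tpi.
Qed.

Lemma td_gen_good n (L : lmodType R) (g : interp (n + 1) L) : good g ->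
  good (fun p q a z y k => ev g (td (tgen (n := n) a z y k))).
Proof.
move=> gg p q a z y i /=; case: asboolP => [[_ H _ _]|_] /=; first exact: H.
by rewrite big1 // => k _; rewrite scaler0.
Qed.

Lemma ev_td n (L : lmodType R) (g : interp (n + 1) L) t :
  ev g (td t) = ev (fun p q a z y k => ev g (td (tgen (n := n) a z y k))) t.
Proof. by elim/term_degree_ind: t => //= [u -> v ->|u ->|r u ->]. Qed.

(** Evaluation after the differential is again evaluation at a [good] interpretation, so it respects
    [teqv] by definition. *)
Lemma td_teqv n (t t' : term n) : teqv t t' -> teqv (td t) (td t').
Proof. by move=> H L g gg; rewrite !ev_td; apply: H; exact: td_gen_good. Qed.

Lemma tf_gen_good n :
  good (fun p q a z y k => tf (tgen (n := n) a z y k)).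
Proof.
move=> p q a z y i /=; case: asboolP => [[_ _ _ H]|_] /=; first exact: H.
by rewrite big1 // => k _; rewrite scaler0.
Qed.

Lemma ev_tf n (t : term n) : tf t = ev (fun p q a z y k => tf (tgen a z y k)) t.
Proof. by elim/term_degree_ind: t => //= [u -> v ->|u ->|r u ->]. Qed.

Lemma tf_teqv n (t t' : term n) : teqv t t' -> tf t = tf t'.
Proof. by move=> H; rewrite !ev_tf; apply: H; exact: tf_gen_good. Qed.

(** For an attached cell this is a clause of [valid]; for the others the differential is already
    zero. *)
Lemma td_td n (t : term n) : teqv (td (td t)) tzero.
Proof.
elim/term_degree_ind: t => [|u IHu v IHv|u IH|r u IH|p q a z y k] L g gg //=.
- by rewrite IHu // IHv //= addr0.
- by rewrite IH //= oppr0.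
- by rewrite IH //= scaler0.
- by case: asboolP => [[H _ _ _]|_] //=; rewrite H.
Qed.

Lemma tf_td n (t : term n) : tf (td t) = dif X n (tf t).
Proof.
elim/term_degree_ind: t => [|u IHu v IHv|u IH|r u IH|p q a z y k] //=.
- by rewrite linear0.
- by rewrite IHu IHv linearD.
- by rewrite IH linearN.
- by rewrite IH linearZ.
- by case: asboolP => [[_ _ H _]|_] //=; rewrite linear0.
Qed.

(** * The resolution as a complex and its map to [X] *)

Definition res_d n (x : res_obj n) : res_obj (n + 1) := tpi (td (lrepr x)).

Lemma res_dE n (t : term n) : res_d (tpi t) = tpi (td t).
Proof. by apply/tpiP/td_teqv/repr_tpi. Qed.

Lemma res_d_linear n : is_linear (@res_d n).
Proof.
move=> a x y; rewrite -(tpi_repr x) -(tpi_repr y) /tpi -lpiZ -lpiD -!/(tpi _).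
by rewrite !res_dE /= /tpi -lpiZ -lpiD.
Qed.

Lemma res_dd n (x : res_obj n) : mklin (@res_d_linear (n + 1)) (mklin (@res_d_linear n) x) = 0.
Proof.
rewrite -(tpi_repr x) /= !res_dE; apply: (iffRL (tpiP _ tzero)); exact: td_td.
Qed.

Definition resolution : complex R :=
  @Complex R res_obj (fun n => mklin (@res_d_linear n)) res_dd.

Definition res_f n (x : res_obj n) : obj X n := tf (lrepr x).

Lemma res_fE n (t : term n) : res_f (tpi t) = tf t.
Proof. exact/tf_teqv/repr_tpi. Qed.

Lemma res_f_linear n : is_linear (@res_f n).
Proof.
move=> a x y; rewrite -(tpi_repr x) -(tpi_repr y) /tpi -lpiZ -lpiD -!/(tpi _).
by rewrite !res_fE.
Qed.

Lemma res_f_comm n (x : obj resolution n) :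
  mklin (@res_f_linear (n + 1)) (dif resolution n x) = dif X n (mklin (@res_f_linear n) x).
Proof. by rewrite -(tpi_repr x) /= res_dE !res_fE tf_td. Qed.

Definition res_map : cochain_map resolution X :=
  @CochainMap R resolution X (fun n => mklin (@res_f_linear n)) res_f_comm.

(** By the lifting criterion, finitely many cocycles of the cone subject to relations [a] need
    primitives subject to [a]. Such cocycles are the attaching data of a cell, whose generators are
    the primitives. *)
Lemma res_map_pure_quasi_iso : pure_quasi_iso res_map.
Proof.
apply: (@raw_pure_exact_of_lift R (fun n => (res_obj (n + 1) * obj X n)%type)).
- by [].
- move=> n a [x y] [x' y']; congr pair => /=.
    by rewrite res_d_linear opprD scalerN.
  by rewrite res_f_linear linearP scalerDr addrACA.
- by [].
- move=> n [x y] _; congr pair => /=.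
    rewrite (islinN (@res_d_linear _)) opprK; exact: res_dd.
  rewrite (islinN (@res_f_linear _)) linearD dif_sq addr0.
  have /= -> := res_f_comm x; exact: addNr.
- move=> n p q a w _ dw aw.
  (* The cone differential sends a generator attached along [(z, y)] to [(-z, y)], whence the
     sign. *)
  pose z k : term (n + 1 + 1) := lrepr (- (w k).1).
  pose y k := (w k).2.
  have zE k : tpi (z k) = - (w k).1 by exact: tpi_repr.
  have a1 i : \sum_k a i k *: (w k).1 = 0.
    by have /(congr1 fst) := aw i; rewrite (big_morph fst (fun _ _ => erefl) erefl).
  have a2 i : \sum_k a i k *: (w k).2 = 0.
    by have /(congr1 snd) := aw i; rewrite (big_morph snd (fun _ _ => erefl) erefl).
  have V : valid a z y (fun k => td (z k)) (fun k => tf (z k)).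
    split=> //.
    - move=> k; apply/tpiP; rewrite -res_dE zE (islinN (@res_d_linear _)).
      exact: (congr1 fst (dw k)).
    - move=> L g gg i; under eq_bigr do rewrite -(ev_good_tpi _ gg) zE.
      have lin := ev_linear gg.
      transitivity (ev g (lrepr (- \sum_k a i k *: (w k).1))).
        rewrite (islinN lin) (islin_sum lin) -sumrN; apply: eq_bigr => k _.
        by rewrite (islinN lin) (islinZ lin) scalerN.
      by rewrite a1 oppr0 (islin0 lin).
    - move=> k; rewrite -res_fE zE (islinN (@res_f_linear _)).
      by apply: (addrI (res_f (w k).1)); rewrite subrr; have /(congr1 snd) := dw k.
  exists (fun k => (tpi (tgen a z y k), 0)); split=> [//|k|i].
  + rewrite /cone_d /= res_dE res_fE /= asboolT //= zE opprK linear0 addr0.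
    by rewrite /y; case: (w k).
  + rewrite [LHS]surjective_pairing; congr pair.
      rewrite (big_morph fst (fun _ _ => erefl) erefl).
      exact: (@linear_good _ _ id (fun _ _ _ => erefl)).
    rewrite (big_morph snd (fun _ _ => erefl) erefl) big1 // => k _.
    exact: scaler0.
Qed.

(** Lifts are chosen cell by cell, each cell being finitely presented, and extended to all terms by
    [ev]. The other two parts of exactness follow from injectivity of [f]. *)
Lemma pure_projective_res n : pure_projective (res_obj n).
Proof.
move=> A B C f g pure.
have [[inj mid _] _] := pure.
have injf x : f x = 0 -> x = 0.
  move=> fx; apply/subr0_eq/inj => //; by rewrite /sq_eq /= fx subrr.
split.
- by move=> h lin fh x; apply/injf/fh.
- move=> h lin; split=> [gh|[h' [lin' e]] x]; last first.
    rewrite /= -e /=; apply/subr0_eq; apply/(mid (f (h' x)) I).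
    by exists (h' x); split=> //; rewrite /sq_eq /= subrr.
  have ex x : exists u, f u = h x.
    have [/(_ _) H _] := mid (h x) I.
    have [|u [_ /subr0_eq e]] := H; last by exists u.
    by have := gh x; rewrite /sq_eq /= => ->; rewrite subrr.
  have [h' Hh'] := choice ex; exists h'; split=> // a x y.
  apply/subr0_eq/injf; rewrite linearB linearP !Hh' lin; exact: subrr.
- move=> h lin.
  have lft p q (a : 'I_p -> 'I_q -> R) (z : 'I_q -> term (n + 1)) (y : 'I_q -> obj X n) :
      exists b : 'I_q -> B, (forall k, g (b k) = h (tpi (tgen a z y k))) /\
        forall i, \sum_k a i k *: b k = 0.
    have [||b [_ e e']] := @pure_ses_lift R A B C (fun=> True) (fun=> True) (fun=> True)
      f g (conj I (fun _ _ _ _ _ => I)) (conj I (fun _ _ _ _ _ => I))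
      (linear_is_linear f) (linear_is_linear g) (fun _ _ => I) pure
      p q a (fun k => h (tpi (tgen a z y k))) => //.
    + by move=> i; exact: (linear_good lin).
    + by exists b.
  pose gb : interp n B := fun p q a z y => projT1 (cid (lft p q a z y)).
  have gbP p q a z y : (forall k, g (gb p q a z y k) = h (tpi (tgen a z y k))) /\
        forall i, \sum_k a i k *: gb p q a z y k = 0.
    by rewrite /gb; case: cid.
  have gg : good gb by move=> p q a z y i; case: (gbP p q a z y).
  exists (fun x => ev gb (lrepr x)); split; first exact: ev_linear.
  move=> x /=; rewrite -[in RHS](tpi_repr x) (linear_tpi _ lin).
  elim/term_degree_ind: (lrepr x) => //= [|u <- v <-|u <-|r u <-|p q a z y k].
  - by rewrite linear0.
  - by rewrite linearD.
  - by rewrite linearN.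
  - by rewrite linearZ.
  - by case: (gbP p q a z y).
Qed.

End Terms.

(** * Linear systems in a pure exact complex *)

(** The kernel-cokernel sequence makes each [y j] a boundary; the system then lifts along the pure
    epimorphism from [obj Y m] onto the image of the differential. *)
Lemma pure_exact_lift (R : pzRingType) (Y : complex R) (m : int) (p q : nat)
    (a : 'I_p -> 'I_q -> R) (y : 'I_q -> obj Y (m + 1)) :
  pure_exact_cx Y -> (forall j, dif Y (m + 1) (y j) = 0) ->
  (forall i, \sum_j a i j *: y j = 0) ->
  exists x : 'I_q -> obj Y m, (forall j, dif Y m (x j) = y j) /\
    forall i, \sum_j a i j *: x j = 0.
Proof.
move=> pY dy ay; have [epic _ [[_ mid _] _]] := pY m.
have imy j : exists x, True /\ dif Y m x = y j.
  have [_ H] := mid (y j) I.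
  have [|x [_ e]] := H; last by exists x; split=> //; rewrite e; exact: subr0.
  by exists (y j); split; [split=> //; exact: dy|exact: subrr].
have sub_ker : submodule (fun x : obj Y m => True /\ dif Y m x = 0).
  split; first by rewrite linear0.
  by move=> r u v [_ du] [_ dv]; rewrite linearP du dv scaler0 addr0.
have [||x [_ e e']] := @pure_ses_lift R _ _ _ _ _ _ id _ sub_ker
  (conj I (fun _ _ _ _ _ => I)) (fun _ _ _ => erefl) (linear_is_linear (dif Y m))
  (fun _ _ => I) epic p q a y => //.
by exists x.
Qed.

(** * Transport of elements between equal degrees *)

Section Cast.
Variables (R : pzRingType) (Y : complex R).

Lemma castc_linear (m m' : int) (e : m = m') : is_linear (castc (Y := Y) e).
Proof. by case: m' / e. Qed.

Lemma castc_id (m : int) (e : m = m) (y : obj Y m) : castc e y = y.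
Proof. by rewrite (eq_irrelevance e erefl). Qed.

Lemma castc_trans (m1 m2 m3 : int) (e : m1 = m2) (e' : m2 = m3) (e'' : m1 = m3)
  (y : obj Y m1) : castc e' (castc e y) = castc e'' y.
Proof. by case: m3 / e' e'' => e''; case: m2 / e e'' => e''; rewrite [RHS]castc_id. Qed.

Lemma dif_castc (m m' : int) (e : m = m') (e' : m + 1 = m' + 1) (y : obj Y m) :
  dif Y m' (castc e y) = castc e' (dif Y m y).
Proof. by case: m' / e e' => e'; rewrite [RHS]castc_id. Qed.

Lemma castc_inj (m m' : int) (e : m = m') : injective (castc (Y := Y) e).
Proof. by case: m' / e. Qed.

Lemma castc_sumZ (m m' : int) (e : m = m') (I : finType) (c : I -> R) (F : I -> obj Y m) :
  castc e (\sum_i c i *: F i) = \sum_i c i *: castc e (F i).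
Proof. by case: m' / e. Qed.

Lemma castcMz (m m' : int) (e : m = m') (y : obj Y m) (k : int) :
  castc e (y *~ k) = castc e y *~ k.
Proof. by case: m' / e. Qed.

End Cast.

Lemma scaleMz (R : pzRingType) (V : lmodType R) (r : R) (v : V) (k : int) :
  r *: (v *~ k) = (r *: v) *~ k.
Proof. exact: (raddfMz (@GRing.scale R V r)). Qed.

Lemma scale_intr (R : pzRingType) (V : lmodType R) (v : V) (k : int) :
  (k%:~R : R) *: v = v *~ k.
Proof.
by case: k => n; rewrite ?NegzE ?mulrNz ?scaleNr -!pmulrn scaler_nat.
Qed.

Section Solve.
Variables (R : pzRingType) (Y : complex R) (pY : pure_exact_cx Y).
Variables (p0 q0 : nat) (b : 'I_p0 -> 'I_q0 -> int).

(** The index [j] runs over the cocycles of the Hom complex, with integral relations [b]; [k] runs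
    over the generators of a cell, with relations [a]. *)
Definition compatible (m : int) p q (a : 'I_p -> 'I_q -> R) (w : 'I_q0 -> 'I_q -> obj Y m) :=
  (forall i j, \sum_k a i k *: w j k = 0) /\ (forall l k, \sum_j w j k *~ b l j = 0).

(* The two systems together present the tensor product over the integers of the
   modules presented by [a] and [b], to which purity of Y applies. *)
Lemma bisystem_lift (m : int) p q (a : 'I_p -> 'I_q -> R)
    (w : 'I_q0 -> 'I_q -> obj Y (m + 1)) :
  (forall j k, dif Y (m + 1) (w j k) = 0) -> compatible a w ->
  exists x : 'I_q0 -> 'I_q -> obj Y m, compatible a x /\
    forall j k, dif Y m (x j k) = w j k.
Proof.
move=> dw [aw bw].
pose I : finType := ('I_q0 * 'I_q)%type; pose J : finType := ('I_p0 * 'I_q + 'I_p * 'I_q0)%type.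
(* An integral relation is repeated for every generator [k], a relation of [a] for every cocycle
   [j]. *)
pose c (t : J) (u : I) : R := match t with
  | inl lk => (u.2 == lk.2)%:R * (b lk.1 u.1)%:~R
  | inr ij => (u.1 == ij.2)%:R * a ij.1 u.2 end.
have sumc1 (V : lmodType R) (F : 'I_q0 -> 'I_q -> V) l k :
    \sum_(u : I) c (inl (l, k)) u *: F u.1 u.2 = \sum_j F j k *~ b l j.
  rewrite -(pair_bigA _ (fun j k' => c (inl (l, k)) (j, k') *: F j k')) /=.
  apply: eq_bigr => j _; rewrite (bigD1 k) //= eqxx mul1r scale_intr big1 ?addr0 //.
  by move=> k' /negPf ->; rewrite mul0r scale0r.
have sumc2 (V : lmodType R) (F : 'I_q0 -> 'I_q -> V) i j :
    \sum_(u : I) c (inr (i, j)) u *: F u.1 u.2 = \sum_k a i k *: F j k.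
  rewrite -(pair_bigA _ (fun j' k => c (inr (i, j)) (j', k) *: F j' k)) /=.
  rewrite (bigD1 j) //= [X in _ + X]big1 ?addr0 => [|j' /negPf j'j].
    by apply: eq_bigr => k _; rewrite eqxx mul1r.
  by rewrite big1 // => k _; rewrite j'j mul0r scale0r.
have [||x [dx cx]] := @pure_exact_lift R Y m #|J| #|I|
  (fun t u => c (enum_val t) (enum_val u))
  (fun u => w (enum_val u).1 (enum_val u).2) pY.
- by move=> u.
- move=> t; rewrite (sum_enum_val (fun u : I => c (enum_val t) u *: w u.1 u.2)).
  by case: (enum_val t) => -[l k]; rewrite ?sumc1 ?sumc2.
pose x' j k := x (enum_rank ((j, k) : I)).
have cx' (t : J) : \sum_(u : I) c t u *: x' u.1 u.2 = 0.
  rewrite -[RHS](cx (enum_rank t)) enum_rankK.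
  rewrite -(sum_enum_rank (fun k => c t (enum_val k) *: x k)).
  by apply: eq_bigr => -[j k] _; rewrite enum_rankK.
exists x'; split.
  split=> [i j|l k]; first by have := cx' (inr (i, j)); rewrite sumc2.
  by have := cx' (inl (l, k)); rewrite sumc1.
by move=> j k; rewrite dx enum_rankK.
Qed.

(* The unconditional [compatible a x] lets [solve] be used before its
   hypotheses have been established. *)
Lemma solve_exists (m m' : int) (e : m + 1 = m') p q (a : 'I_p -> 'I_q -> R)
    (w : 'I_q0 -> 'I_q -> obj Y m') :
  exists x : 'I_q0 -> 'I_q -> obj Y m, compatible a x /\
    ((forall j k, dif Y m' (w j k) = 0) -> compatible a w ->
     forall j k, castc e (dif Y m (x j k)) = w j k).
Proof.
case: m' / e w => w.
have [[dw cw]|nw] := pselect ((forall j k, dif Y (m + 1) (w j k) = 0) /\ compatible a w).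
  by have [x [cx dx]] := bisystem_lift dw cw; exists x.
exists (fun _ _ => 0); split=> [|dw cw]; last by case: nw.
split=> *; rewrite big1 // => *; [exact: scaler0|exact: mul0rz].
Qed.

Definition solve (m m' : int) (e : m + 1 = m') p q (a : 'I_p -> 'I_q -> R)
    (w : 'I_q0 -> 'I_q -> obj Y m') : 'I_q0 -> 'I_q -> obj Y m :=
  projT1 (cid (solve_exists e a w)).

Lemma solveP (m m' : int) (e : m + 1 = m') p q (a : 'I_p -> 'I_q -> R) w :
  compatible a (solve e a w) /\
    ((forall j k, dif Y m' (w j k) = 0) -> compatible a w ->
     forall j k, castc e (dif Y m (solve e a w j k)) = w j k).
Proof. by rewrite /solve; case: cid. Qed.

End Solve.

(** * Pure exactness of Hom out of the resolution *)

Section HomModule.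
Variables (R : pzRingType) (P Y : complex R) (n : int).
Notation hom := (hom_car P Y n).

HB.instance Definition _ := gen_eqMixin hom.
HB.instance Definition _ := gen_choiceMixin hom.

Let hadd (f g : hom) : hom := fun i x => f i x + g i x.
Let hopp (f : hom) : hom := fun i x => - f i x.
Let hscale (z : int) (f : hom) : hom := fun i x => f i x *~ z.

Let homext (f g : hom) : (forall i x, f i x = g i x) -> f = g.
Proof. by move=> fg; apply: functional_extensionality_dep => i; apply: funext => x. Qed.

Let haddA : associative hadd.
Proof. by move=> f g h; apply: homext => i x; exact: addrA. Qed.
Let haddC : commutative hadd.
Proof. by move=> f g; apply: homext => i x; exact: addrC. Qed.
Let hadd0 : left_id ((fun _ _ => 0) : hom) hadd.
Proof. by move=> f; apply: homext => i x; exact: add0r. Qed.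
Let haddN : left_inverse ((fun _ _ => 0) : hom) hopp hadd.
Proof. by move=> f; apply: homext => i x; exact: addNr. Qed.

HB.instance Definition _ := GRing.isZmodule.Build hom haddA haddC hadd0 haddN.

Let hscaleA a b (f : hom) : hscale a (hscale b f) = hscale (a * b) f.
Proof. by apply: homext => i x; rewrite /hscale mulrC mulrzA. Qed.
Let hscale1 : left_id 1 hscale.
Proof. by move=> f; apply: homext => i x; exact: mulr1z. Qed.
Let hscaleDr : right_distributive hscale +%R.
Proof. by move=> a f g; apply: homext => i x; exact: mulrzDl. Qed.
Let hscaleDl f : {morph hscale^~ f : a b / a + b}.
Proof. by move=> a b; apply: homext => i x; exact: mulrzDr. Qed.

HB.instance Definition _ :=
  GRing.Zmodule_isLmodule.Build int hom hscaleA hscale1 hscaleDr hscaleDl.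

(** Its operations are convertible to those of [hom_mops], so the lifting criterion applies to the
    Hom complex over the integers. *)
Definition hom_mod : lmodType int := hom.

Lemma hom_ext (f g : hom_mod) : (forall i x, f i x = g i x) -> f = g.
Proof. exact: homext. Qed.

Lemma hom_sumZ (q : nat) (c : 'I_q -> int) (F : 'I_q -> hom_mod) i x :
  (\sum_j c j *: F j : hom_mod) i x = \sum_j F j i x *~ c j.
Proof.
by rewrite (big_morph (fun f : hom_mod => f i x) (id1 := 0) (op1 := +%R)
  (fun _ _ => erefl) erefl).
Qed.

End HomModule.

Lemma sumMz (V : zmodType) (I : finType) (F : I -> V) (k : int) :
  (\sum_i F i) *~ k = \sum_i F i *~ k.
Proof. by elim/big_rec2: _ => [|i x y _ <-]; rewrite ?mul0rz ?mulrzDl. Qed.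

Lemma exprz_succ_opp (n : int) : (-1 : int) ^ (n + 1) = - (-1) ^ n.
Proof. by rewrite exprzDr // expr1z mulrN1. Qed.

Lemma difMz (R : pzRingType) (Y : complex R) (m : int) (y : obj Y m) (k : int) :
  dif Y m (y *~ k) = dif Y m y *~ k.
Proof. exact: (raddfMz (dif Y m)). Qed.

(** * Primitives of finitely many cocycles subject to integral relations *)

Section HomExact.
Variables (R : pzRingType) (X Y : complex R) (pY : pure_exact_cx Y) (n : int).
Variables (p0 q0 : nat) (b : 'I_p0 -> 'I_q0 -> int).
Variable Phi : 'I_q0 -> hom_car (resolution X) Y (n + 1).
Arguments Phi : clear implicits.
Hypothesis Philin : forall j, hom_lin (Phi j).
Hypothesis dPhi : forall j i x, hom_d (Phi j) (i := i) x = 0.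
Hypothesis bPhi : forall l i x, \sum_j Phi j i x *~ b l j = 0.

Notation td t := (tdf t).1.
Notation tf t := (tdf t).2.

(** On a generator $e$ the equation $d\psi = \Phi$ reads $d_Y(\psi e) = \Phi e + (-1)^n \psi(d e)$,
    and $\psi(d e)$ is known by recursion on [z]. The conditional spells out [td] on the generator,
    so that recursive calls are visibly on subterms. All cocycles and all generators of the cell are
    handled by one call of [solve], which preserves both kinds of relations. *)
Fixpoint primitive (i : int) (t : term X i) : 'I_q0 -> obj Y (i + n) :=
  match t with
  | tzero => fun=> 0
  | tadd u v => fun j => primitive u j + primitive v j
  | topp u => fun j => - primitive u j
  | tscale r u => fun j => r *: primitive u j
  | tgen p q a z y k => fun j =>
      solve pY b (hom_eA i n) a (fun j' k' => Phi j' i (tpi (tgen a z y k')) +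
        castc (hom_eB i n)
          (if `[< valid a z y (fun k => td (z k)) (fun k => tf (z k)) >]
           then primitive (z k') j' else 0) *~ (-1) ^ n) j k
  end.

Lemma primitive_good i j :
  good (fun p q a z y k => primitive (tgen (n := i) a z y k) j).
Proof.
by move=> p q a z y l; exact: (solveP pY b (hom_eA i n) a _).1.1.
Qed.

Lemma ev_primitive i (t : term X i) j :
  primitive t j = ev (fun p q a z y k => primitive (tgen a z y k) j) t.
Proof. by elim/term_degree_ind: t => //= [u -> v ->|u ->|r u ->]. Qed.

Lemma primitive_teqv i (t t' : term X i) j : teqv t t' -> primitive t j = primitive t' j.
Proof. by move=> H; rewrite !ev_primitive; apply: H; exact: primitive_good. Qed.

Lemma primitive_rel i (t : term X i) l : \sum_j primitive t j *~ b l j = 0.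
Proof.
elim/term_degree_ind: t => /= [|u IHu v IHv|u IH|r u IH|p q a z y k].
- by rewrite big1 // => j _; exact: mul0rz.
- by under eq_bigr do rewrite mulrzDl; rewrite big_split /= IHu IHv addr0.
- by under eq_bigr do rewrite mulNrz; rewrite sumrN IH oppr0.
- by under eq_bigr do rewrite -scaleMz; rewrite -scaler_sumr IH scaler0.
- exact: (solveP pY b (hom_eA i n) a _).1.2.
Qed.

(** On a generator the right-hand side must be shown to be a compatible family of cocycles of [Y].
    Its differential is $d_Y \Phi e + (-1)^n d_Y \psi(d e)$; the first term is $(-1)^{n+1} \Phi(d
    e)$ because $\Phi$ is a cocycle, the second $(-1)^n \Phi(d e)$ by induction. *)
Lemma primitive_d i (t : term X i) j :
  castc (hom_eA i n) (dif Y _ (primitive t j)) =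
  Phi j i (tpi t) + castc (hom_eB i n) (primitive (td t) j) *~ (-1) ^ n.
Proof.
have cl m m' (e : m = m') := @castc_linear R Y m m' e.
(* The degree varies in this induction, so that the hypothesis reaches the attaching terms [z]. *)
elim: t j => {i} [i|i u IHu v IHv|i u IH|i r u IH|i p q a z IHz y k] j /=.
- rewrite linear0 !(islin0 (cl _ _ _)) mul0rz addr0; exact: esym (islin0 (@Philin j i)).
- rewrite linearD !(islinD (cl _ _ _)) IHu IHv mulrzDl addrACA -(islinD (@Philin j _)).
  by congr (Phi j i _ + _); rewrite /tpi lpiD.
- rewrite linearN !(islinN (cl _ _ _)) IH mulNrz opprD -(islinN (@Philin j _)).
  by congr (Phi j i _ + _); rewrite /tpi lpiN.
- rewrite linearZ !(islinZ (cl _ _ _)) IH -scaleMz scalerDr -(islinZ (@Philin j _)).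
  by congr (Phi j i _ + _); rewrite /tpi lpiZ.
set w := (fun (j' : 'I_q0) (k' : 'I_q) => _ : obj Y (i + (n + 1))).
have wE j' k' : w j' k' = Phi j' i (tpi (tgen a z y k')) +
    castc (hom_eB i n) (primitive (td (tgen a z y k')) j') *~ (-1) ^ n.
  by rewrite /w /=; case: asboolP.
rewrite (solveP pY b (hom_eA i n) a w).2; first by rewrite wE.
- move=> j' k'; rewrite wE.
  set g := tgen a z y k'; set u := primitive (td g) j'.
  (* The induction hypothesis on [z], simplified because the differential squares to zero. *)
  have du : castc (hom_eA (i + 1) n) (dif Y _ u) = Phi j' (i + 1) (tpi (td g)).
    have -> : castc (hom_eA (i + 1) n) (dif Y _ u) = Phi j' (i + 1) (tpi (td g)) +
        castc (hom_eB (i + 1) n) (primitive (td (td g)) j') *~ (-1) ^ n.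
      rewrite /u /g /=; case: asboolP => [_|_] /=; first exact: IHz.
      rewrite linear0 !(islin0 (cl _ _ _)) mul0rz addr0.
      exact: esym (islin0 (@Philin j' (i + 1))).
    by rewrite (primitive_teqv _ (td_td g)) /= (islin0 (cl _ _ _)) mul0rz addr0.
  have := dPhi j' (tpi g); rewrite /hom_d.
  have -> : dif (resolution X) i (tpi g) = tpi (td g) by exact: res_dE.
  rewrite -du exprz_succ_opp mulrNz opprK => dP0.
  apply: (@castc_inj R Y _ _ (hom_eA i (n + 1))); rewrite [RHS](islin0 (cl _ _ _)).
  rewrite -[RHS]dP0 linearD (islinD (cl _ _ _)); congr (_ + _).
  have e' : i + 1 + n + 1 = i + (n + 1) + 1 by rewrite hom_eB.
  rewrite difMz (dif_castc _ e') !castcMz; congr (_ *~ _).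
  have e'' : i + 1 + n + 1 = i + (n + 1 + 1) by rewrite e' hom_eA.
  by rewrite !(castc_trans _ _ e'').
(* Relations of the cell hold since both summands come from [good] interpretations; the integral
   ones hold by [bPhi] and [primitive_rel]. *)
- split=> [l j'|l k'].
  + under eq_bigr do rewrite wE scalerDr.
    rewrite big_split /= (linear_good (@Philin j' i)) add0r.
    transitivity (castc (hom_eB i n)
      (\sum_k a l k *: primitive (td (tgen a z y k)) j') *~ (-1) ^ n).
      rewrite castc_sumZ sumMz; apply: eq_bigr => k' _; exact: scaleMz.
    under eq_bigr do rewrite ev_primitive.
    rewrite (td_gen_good (@primitive_good (i + 1) j')) (islin0 (cl _ _ _)).
    exact: mul0rz.
  + under eq_bigr do rewrite wE mulrzDl.
    rewrite big_split /= bPhi add0r.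
    transitivity (castc (hom_eB i n)
      (\sum_j primitive (td (tgen a z y k')) j *~ b l j) *~ (-1) ^ n).
      rewrite (islin_sum (cl _ _ _)) sumMz; apply: eq_bigr => j' _.
      by rewrite castcMz mulrzAC.
    by rewrite primitive_rel (islin0 (cl _ _ _)) mul0rz.
Qed.

Definition hom_primitive (j : 'I_q0) : hom_car (resolution X) Y n :=
  fun i x => primitive (lrepr x) j.

Lemma primitive_tpi i (t : term X i) j : primitive (lrepr (tpi t)) j = primitive t j.
Proof. exact/primitive_teqv/repr_tpi. Qed.

Lemma hom_primitive_lin j : hom_lin (hom_primitive j).
Proof.
move=> i r x y; rewrite /hom_primitive -{1}(tpi_repr x) -{1}(tpi_repr y).
by rewrite /tpi -lpiZ -lpiD primitive_tpi.
Qed.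

Lemma hom_primitive_d j i x : hom_d (hom_primitive j) (i := i) x = Phi j i x.
Proof.
rewrite /hom_d /hom_primitive primitive_d primitive_tpi addrK.
by congr (Phi j i _); exact: tpi_repr.
Qed.

Lemma hom_primitive_rel l i x : \sum_j hom_primitive j (i := i) x *~ b l j = 0.
Proof. exact: primitive_rel. Qed.

End HomExact.

(** * The Hom complex as a complex of abelian groups *)

Section HomComplex.
Variables (R : pzRingType) (P Y : complex R).

Let cl m m' (e : m = m') : is_linear (castc (Y := Y) e).
Proof. exact: castc_linear. Qed.

Lemma hom_lin_submodule n : @submodule int (hom_mod P Y n) (@hom_lin R P Y n).
Proof.
split=> [i r u v|c f g lf lg i r u v]; first by rewrite scaler0 addr0.
transitivity (f i (r *: u + v) *~ c + g i (r *: u + v)) => //.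
rewrite lf lg mulrzDl -scaleMz addrACA -scalerDr //.
Qed.

Lemma hom_d_linear n : @is_linear int (hom_mod P Y n) (hom_mod P Y (n + 1)) (@hom_d R P Y n).
Proof.
move=> c f g; apply: hom_ext => i x.
transitivity (hom_d f x *~ c + hom_d g x) => //; rewrite /hom_d.
have E j (u : obj P j) : (c *: f + g : hom_mod P Y n) j u = f j u *~ c + g j u by [].
rewrite !E linearD difMz !(islinD (@cl _ _ _)) !castcMz mulrzDl opprD.
by rewrite addrACA mulrzBl (mulrzAC c).
Qed.

Lemma hom_d_lin n (f : hom_car P Y n) : hom_lin f -> hom_lin (hom_d f).
Proof.
move=> lf i r u v; rewrite /hom_d !(linearP, lf, cl) mulrzDl opprD addrACA scalerBr.
by rewrite scaleMz.
Qed.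

(** The two mixed terms cancel because the sign of the Hom differential alternates with the
    degree. *)
Lemma hom_dd n (f : hom_car P Y n) i x : hom_lin f -> hom_d (hom_d f) (i := i) x = 0.
Proof.
move=> lf.
have E m (f' : hom_car P Y m) j (u : obj P j) : hom_d f' u = castc (hom_eA j m)
  (dif Y _ (f' j u)) - castc (hom_eB j m) (f' (j + 1) (dif P j u)) *~ (-1) ^ m by [].
rewrite !E.
rewrite dif_sq (islin0 (lf _)) (islin0 (@cl _ _ _)) mul0rz subr0.
(* These equalities identify the various forms of the target degree, so that successive transports
   merge into one. *)
have e1 : i + n + 1 + 1 = i + (n + 1) + 1 by rewrite (hom_eA i n).
have e2 : i + 1 + n + 1 = i + (n + 1) + 1 by rewrite (hom_eB i n).
have e3 : i + 1 + n + 1 = i + (n + 1 + 1) by rewrite e2 (hom_eA i (n + 1)).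
rewrite linearB difMz (dif_castc _ e1) (dif_castc _ e2) dif_sq (islin0 (@cl _ _ _)) sub0r.
rewrite (islinN (@cl _ _ _)) castcMz !(castc_trans _ _ e3) exprz_succ_opp mulrNz opprK.
exact: addNr.
Qed.

End HomComplex.

(** Over the integers the lifting criterion asks for primitives of finitely many cocycles that keep
    their integral relations, as supplied by [hom_primitive]. *)
Lemma hom_resolution_pure_exact (R : pzRingType) (X Y : complex R) :
  pure_exact_cx Y -> hom_pure_exact (resolution X) Y.
Proof.
move=> pY; apply: (@raw_pure_exact_of_lift int (hom_mod (resolution X) Y)).
- exact: hom_lin_submodule.
- exact: hom_d_linear.
- exact: hom_d_lin.
- by move=> n f lf; apply: hom_ext => i x; exact: hom_dd.
- move=> n p q b Phi lPhi dPhi bPhi.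
  have d0 j i x : hom_d (Phi j) (i := i) x = 0 by rewrite dPhi.
  have b0 l i x : \sum_j Phi j i x *~ b l j = 0 by rewrite -hom_sumZ bPhi.
  exists (hom_primitive pY b Phi); split=> [j|j|l].
  + exact: hom_primitive_lin.
  + by apply: hom_ext => i x; exact: hom_primitive_d.
  + by apply: hom_ext => i x; rewrite hom_sumZ; exact: hom_primitive_rel.
Qed.

Theorem theorem5p1 (R : pzRingType) (X : complex R) :
  bounded_below X ->
  exists (P : complex R) (f : cochain_map P X),
    [/\ forall n : int, pure_projective (obj P n),
        pure_quasi_iso f
      & forall Y : complex R, pure_exact_cx Y -> hom_pure_exact P Y].
Proof.
move=> _; exists (resolution X), (res_map X); split.
- exact: pure_projective_res.
- exact: res_map_pure_quasi_iso.
- exact: hom_resolution_pure_exact.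
Qed.
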